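(* Let $\mathcal M$ be a minimal time-like surface in $\mathbb R^4_2$ with Gauss curvature $K$ and curvature of the normal connection $\varkappa$, and let $p$ be a point on $\mathcal M$. Then: (1) the point $p$ is degenerate if and only if $K^2(p)-\varkappa^2(p)=0$; (2) the surface $\mathcal M$ is of the first or the second type if and only if $K^2-\varkappa^2>0$ (at all points of $\mathcal M$); (3) the surface $\mathcal M$ is of the third type if and only if $K^2-\varkappa^2<0$ (at all points of $\mathcal M$).
   Context: All maps are smooth and domains (and surfaces) are connected. $\mathbb R^4_2$ is $\mathbb R^4$ with scalar product $a\cdot b=-a_1b_1+a_2b_2-a_3b_3+a_4b_4$ and its standard orientation; $a^2=a\cdot a$. Double numbers: $\mathbb D=\{t=u+\mathrm jv:u,v\in\mathbb R\}$, $\mathrm j^2=1$, $\bar t=u-\mathrm jv$, $|t|^2=t\bar t=u^2-v^2$; $\mathbb D_0=\{t:|t|^2=0\}$; $\mathbb D_+=\{t:|t|^2>0,\ \mathrm{Re}\,t>0\}$; $\frac{\partial}{\partial t}=\frac12(\frac{\partial}{\partial u}+\mathrm j\frac{\partial}{\partial v})$. $\mathbb D^4_2$ is $\mathbb D^4$ with the $\mathbb D$-bilinear extension of the scalar product. A time-like surface $\mathcal M=(\mathcal D,x)$ is an immersion $x:\mathcal D\to\mathbb R^4_2$, $\mathcal D\subset\mathbb R^2$ a domain, whose induced scalar product on tangent planes is indefinite (signature $(1,1)$). Coordinates $(u,v)$ are isothermal if $x_u^2=-x_v^2$ and $x_u\cdot x_v=0$; always with $E=x_u^2<0$ (they exist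 near every point). Let $\sigma$ be the second fundamental form, $(X_1,X_2)$ an orthonormal tangent frame with $X_1^2=-1$, $X_2^2=1$, and $(n_1,n_2)$ an orthonormal normal frame with $n_1^2=-1$, $n_2^2=1$ such that $(X_1,X_2,n_1,n_2)$ is right (positively) oriented. The surface is minimal if $\frac12(-\sigma(X_1,X_1)+\sigma(X_2,X_2))=0$. Gauss curvature: $K=-R(X_1,X_2)X_2\cdot X_1$; $\varkappa=R^N(X_1,X_2)n_2\cdot n_1$, where $R,R^N$ are the curvature tensors of the Levi-Civita and the normal connections, with $R(X,Y)=\nabla_X\nabla_Y-\nabla_Y\nabla_X-\nabla_{[X,Y]}$ (similarly $R^N$). For isothermal $t=u+\mathrm jv$ put $\Phi=x_u+\mathrm jx_v$ and $\Phi'=\partial\Phi/\partial t$; $\Phi'^\bot$ is the projection of $\Phi'$ to the complexified normal space (the $\mathbb D$-span of the normal space), along the complexified tangent space, and ${\Phi'^\bot}^2=\Phi'^\bot\cdot\Phi'^\bot\in\mathbb D$. A point $p$ is degenerate if ${\Phi'^\bot}^2(p)\in\mathbb D_0$. A minimal time-like surface without degenerate points is said to be of general type; it is of the first type if ${\Phi'^\bot}^2\in\mathbb D_+$, of the second type if $-{\Phi'^\bot}^2\in\mathbb D_+$, of the third type if $\pm\mathrm j{\Phi'^\bot}^2\in\mathbb D_+$, i.e. $|{\Phi'^\bot}^2|^2<0$ (at all points). These notions do not depend on the choice of isothermal coordinates. *)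

(* Defs.v *)
From HB Require Import structures.
From mathcomp Require Import all_boot all_order all_algebra.
From mathcomp Require Import all_classical all_reals all_analysis.
From mathcomp Require Import ring.

Set Implicit Arguments.
Unset Strict Implicit.
Unset Printing Implicit Defensive.

Import Order.TTheory GRing.Theory Num.Theory.
Import numFieldNormedType.Exports.

Local Open Scope classical_set_scope.
Local Open Scope ring_scope.

(* Double numbers: [Double u v] is u + j v, where j ^ 2 = 1. *)

Record double (R : Type) : Type := Double { dbl_re : R; dbl_im : R }.

Definition double_pair (R : Type) (t : double R) : R * R :=
  (dbl_re t, dbl_im t).
Definition pair_double (R : Type) (p : R * R) : double R := Double p.1 p.2.

Lemma double_pairK (R : Type) : cancel (@double_pair R) (@pair_double R).
Proof. by case. Qed.

HB.instance Definition _ (R : eqType) :=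
  Equality.copy (double R) (can_type (@double_pairK R)).
HB.instance Definition _ (R : choiceType) :=
  Choice.copy (double R) (can_type (@double_pairK R)).

Section DoubleRing.
Variable R : comNzRingType.
Implicit Types s t r : double R.

Definition dbl_real (a : R) : double R := Double a 0.
Definition dbl_j : double R := Double 0 1.

Definition dbl_add s t :=
  Double (dbl_re s + dbl_re t) (dbl_im s + dbl_im t).
Definition dbl_opp t := Double (- dbl_re t) (- dbl_im t).
Definition dbl_mul s t :=
  Double (dbl_re s * dbl_re t + dbl_im s * dbl_im t)
         (dbl_re s * dbl_im t + dbl_im s * dbl_re t).

Fact dbl_addA : associative dbl_add.
Proof. by move=> s t r; rewrite /dbl_add /= !addrA. Qed.
Fact dbl_addC : commutative dbl_add.
Proof. by move=> s t; congr Double; rewrite addrC. Qed.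
Fact dbl_add0 : left_id (dbl_real 0) dbl_add.
Proof. by case=> a b; rewrite /dbl_add /= !add0r. Qed.
Fact dbl_addN : left_inverse (dbl_real 0) dbl_opp dbl_add.
Proof. by case=> a b; rewrite /dbl_add /= !addNr. Qed.

HB.instance Definition _ :=
  GRing.isZmodule.Build (double R) dbl_addA dbl_addC dbl_add0 dbl_addN.

Fact dbl_mulA : associative dbl_mul.
Proof.
by move=> [a b] [c d] [e f]; congr Double => /=; ring.
Qed.
Fact dbl_mulC : commutative dbl_mul.
Proof.
by move=> [a b] [c d]; congr Double => /=; ring.
Qed.
Fact dbl_mul1 : left_id (dbl_real 1) dbl_mul.
Proof. by case=> a b; rewrite /dbl_mul /= !mul1r !mul0r !addr0. Qed.
Fact dbl_mulD : left_distributive dbl_mul dbl_add.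
Proof.
by move=> [a b] [c d] [e f]; congr Double => /=; ring.
Qed.
Fact dbl_1neq0 : dbl_real 1 != 0.
Proof. by apply/eqP => -[] /eqP; rewrite oner_eq0. Qed.

HB.instance Definition _ :=
  GRing.Zmodule_isComNzRing.Build (double R)
    dbl_mulA dbl_mulC dbl_mul1 dbl_mulD dbl_1neq0.

End DoubleRing.

Arguments dbl_j {R}.

Definition dbl_norm2 (R : comNzRingType) (t : double R) : R :=
  dbl_re t ^+ 2 - dbl_im t ^+ 2.

Definition in_D0 (R : realType) (t : double R) : Prop := dbl_norm2 t = 0.
Definition in_Dplus (R : realType) (t : double R) : Prop :=
  0 < dbl_norm2 t /\ 0 < dbl_re t.

(* The scalar product of signature (-,+,-,+), over any commutative ring: over
   [R] it is that of R^4_2, over [double R] it is its D-bilinear extension. *)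

Definition eta42 (A : comNzRingType) : 'M[A]_4 :=
  diag_mx (\row_(i < 4) (-1) ^+ i.+1).
Definition sprod (A : comNzRingType) (a b : 'rV[A]_4) : A :=
  (a *m eta42 A *m b^T) 0 0.

Section Surfaces.
Variable R : realType.
Local Notation plane := 'rV[R]_2.
Local Notation space := 'rV[R]_4.

Definition pd (W : normedModType R) (i : 'I_2) (f : plane -> W) : plane -> W :=
  fun q => 'D_(delta_mx 0 i) f q.

(* C^infinity: iterated partial derivatives of all orders are differentiable
   (hence continuous). *)
Definition smooth_on (W : normedModType R) (U : set plane) (f : plane -> W) :=
  forall (s : seq 'I_2) q, U q -> differentiable (foldr (@pd W) f s) q.

Definition plane_domain (D : set plane) : Prop :=
  [/\ open D, connected D & D !=set0].

Section Geometry.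
Variable x : plane -> space.

(* Tangent vector fields are given by their components in the parameters: the
   field [X] stands for the field [push X] along the surface. *)
Definition push (X : plane -> plane) (q : plane) : space := X q *m 'J x q.

Definition tangent_space (q : plane) : 'M[R]_4 := <<'J x q>>%MS.
Definition normal_space (q : plane) : 'M[R]_4 :=
  kermx (eta42 R *m ('J x q)^T).

Definition normal_proj (q : plane) : 'M[R]_4 :=
  proj_mx (normal_space q) (tangent_space q).

Definition first_form (q : plane) : 'M[R]_2 :=
  'J x q *m eta42 R *m ('J x q)^T.
Definition metric (X Y : plane -> plane) (q : plane) : R :=
  (X q *m first_form q *m (Y q)^T) 0 0.

Definition second_form (X Y : plane -> plane) (q : plane) : space :=
  'D_(X q) (push Y) q *m normal_proj q.

Definition christoffel (q : plane) (k i j : 'I_2) : R :=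
  2^-1 * \sum_l invmx (first_form q) k l *
    (pd i (fun r => first_form r j l : R^o) q
     + pd j (fun r => first_form r i l : R^o) q
     - pd l (fun r => first_form r i j : R^o) q).

Definition levi_civita (X Y : plane -> plane) (q : plane) : plane :=
  'D_(X q) Y q
  + \row_k \sum_i \sum_j christoffel q k i j * X q 0 i * Y q 0 j.

Definition normal_connection (X : plane -> plane) (n : plane -> space)
    (q : plane) : space :=
  'D_(X q) n q *m normal_proj q.

Definition lie_bracket (X Y : plane -> plane) (q : plane) : plane :=
  'D_(X q) Y q - 'D_(Y q) X q.

Definition curvature (V : zmodType)
    (nabla : (plane -> plane) -> (plane -> V) -> plane -> V)
    (X Y : plane -> plane) (Z : plane -> V) (q : plane) : V :=
  nabla X (nabla Y Z) q - nabla Y (nabla X Z) q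
  - nabla (lie_bracket X Y) Z q.

Definition tangent_frame (U : set plane) (X1 X2 : plane -> plane) : Prop :=
  [/\ smooth_on U X1, smooth_on U X2 &
      forall q, U q -> [/\ metric X1 X1 q = -1, metric X2 X2 q = 1 &
                           metric X1 X2 q = 0]].

Definition normal_frame (U : set plane) (n1 n2 : plane -> space) : Prop :=
  [/\ smooth_on U n1, smooth_on U n2 &
      forall q, U q ->
        [/\ (n1 q <= normal_space q)%MS, (n2 q <= normal_space q)%MS,
            sprod (n1 q) (n1 q) = -1, sprod (n2 q) (n2 q) = 1 &
            sprod (n1 q) (n2 q) = 0]].

Definition right_oriented (U : set plane) (X1 X2 : plane -> plane)
    (n1 n2 : plane -> space) : Prop :=
  forall q, U q ->
    0 < \det (\matrix_(i < 4)
                [:: push X1 q; push X2 q; n1 q; n2 q]`_i : 'M[R]_4).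

End Geometry.

(* [x] need not be injective: a point of the surface is a parameter [p] in
   [D]. *)
Definition timelike_surface (D : set plane) (x : plane -> space) : Prop :=
  [/\ plane_domain D, smooth_on D x &
      forall q, D q ->
        row_free ('J x q) /\
        exists a b : plane, sprod (a *m 'J x q) (a *m 'J x q) < 0
                         /\ 0 < sprod (b *m 'J x q) (b *m 'J x q)].

Definition neighborhood_in (D : set plane) (p : plane) (U : set plane) :=
  [/\ open U, U p & U `<=` D].

(* The mean curvature vector, K and kappa are defined through an orthonormal
   frame and do not depend on it; orthonormal frames exist only locally in
   general, so each of the following asks for one around every point. *)

Definition minimal (D : set plane) (x : plane -> space) : Prop :=
  forall p, D p -> exists U X1 X2,
    [/\ neighborhood_in D p U, tangent_frame x U X1 X2 &
        2^-1 *: (- second_form x X1 X1 p + second_form x X2 X2 p) = 0].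

Definition gauss_curvature (D : set plane) (x : plane -> space)
    (K : plane -> R) : Prop :=
  forall p, D p -> exists U X1 X2,
    [/\ neighborhood_in D p U, tangent_frame x U X1 X2 &
        K p = - metric x (curvature (levi_civita x) X1 X2 X2) X1 p].

Definition normal_curvature (D : set plane) (x : plane -> space)
    (kappa : plane -> R) : Prop :=
  forall p, D p -> exists U X1 X2 n1 n2,
    [/\ neighborhood_in D p U, tangent_frame x U X1 X2,
        normal_frame x U n1 n2, right_oriented x U X1 X2 n1 n2 &
        kappa p = sprod (curvature (normal_connection x) X1 X2 n2 p) (n1 p)].

(* Local coordinates are a chart [psi] = (u, v) of the parameter domain;
   [coord_field psi i] is the coordinate field d/du (i = 0) or d/dv (i = 1),
   i.e. the field along which the derivative of [psi] is the i-th basis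
   vector. *)

Definition coordinates (U : set plane) (psi : plane -> plane) : Prop :=
  [/\ smooth_on U psi, set_inj U psi &
      forall q, U q -> 'J psi q \in unitmx].

Definition coord_field (psi : plane -> plane) (i : 'I_2) (q : plane) : plane :=
  row i (invmx ('J psi q)).

Definition cpd (psi : plane -> plane) (i : 'I_2) (f : plane -> space)
    (q : plane) : space :=
  'D_(coord_field psi i q) f q.

Definition isothermal (U : set plane) (x : plane -> space)
    (psi : plane -> plane) : Prop :=
  coordinates U psi /\
  forall q, U q ->
    let xu := cpd psi 0 x q in
    let xv := cpd psi 1 x q in
    [/\ sprod xu xu < 0, sprod xu xu = - sprod xv xv & sprod xu xv = 0].

(* a + j b in D^4, for a and b in R^4. *)
Definition dvec (a b : space) : 'rV[double R]_4 :=
  map_mx (@dbl_real R) a + dbl_j *: map_mx (@dbl_real R) b.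

Definition dcpd (psi : plane -> plane) (i : 'I_2)
    (F : plane -> 'rV[double R]_4) (q : plane) : 'rV[double R]_4 :=
  dvec (cpd psi i (fun r => map_mx (@dbl_re R) (F r)) q)
       (cpd psi i (fun r => map_mx (@dbl_im R) (F r)) q).

(* d/dt = 1/2 (d/du + j d/dv). *)
Definition ddt (psi : plane -> plane) (F : plane -> 'rV[double R]_4)
    (q : plane) : 'rV[double R]_4 :=
  dbl_real 2^-1 *: (dcpd psi 0 F q + dbl_j *: dcpd psi 1 F q).

Definition Phi (x : plane -> space) (psi : plane -> plane) (q : plane) :=
  dvec (cpd psi 0 x q) (cpd psi 1 x q).

(* The D-linear extension of the normal projection is the projection to the
   complexified normal space along the complexified tangent space. *)
Definition dPhi_perp (x : plane -> space) (psi : plane -> plane) (q : plane) :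
    'rV[double R]_4 :=
  ddt psi (Phi x psi) q *m map_mx (@dbl_real R) (normal_proj x q).

Definition dPhi_perp_sq (x : plane -> space) (psi : plane -> plane)
    (q : plane) : double R :=
  sprod (dPhi_perp x psi q) (dPhi_perp x psi q).

(* The value of dPhi_perp_sq at [p] in some isothermal coordinates around [p]
   satisfies [S]; for the conditions [S] used below the choice of coordinates
   is immaterial. *)
Definition dPhi_perp_sq_in (S : double R -> Prop) (D : set plane)
    (x : plane -> space) (p : plane) : Prop :=
  exists U psi, [/\ neighborhood_in D p U, isothermal U x psi &
                    S (dPhi_perp_sq x psi p)].

Definition degenerate (D : set plane) (x : plane -> space) (p : plane) :=
  dPhi_perp_sq_in (@in_D0 R) D x p.

Definition general_type (D : set plane) (x : plane -> space) : Prop :=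
  forall p, D p -> ~ degenerate D x p.

Definition first_type (D : set plane) (x : plane -> space) : Prop :=
  general_type D x /\
  forall p, D p -> dPhi_perp_sq_in (@in_Dplus R) D x p.

Definition second_type (D : set plane) (x : plane -> space) : Prop :=
  general_type D x /\
  forall p, D p -> dPhi_perp_sq_in (fun t => in_Dplus (- t)) D x p.

Definition third_type (D : set plane) (x : plane -> space) : Prop :=
  general_type D x /\
  forall p, D p ->
    dPhi_perp_sq_in
      (fun t => in_Dplus (dbl_j * t) \/ in_Dplus (- (dbl_j * t))) D x p.

End Surfaces.

(* Main.v *)
From HB Require Import structures.
From mathcomp Require Import all_boot all_order all_algebra.
From mathcomp Require Import all_classical all_reals all_analysis.
From mathcomp Require Import ring lra.
Require Import Defs.

Set Implicit Arguments.
Unset Strict Implicit.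
Unset Printing Implicit Defensive.

Import Order.TTheory GRing.Theory Num.Theory.
Import numFieldNormedType.Exports.

Local Open Scope classical_set_scope.
Local Open Scope ring_scope.

(** Fix an orthonormal tangent frame (X1, X2) at a point, write s11, s12, s22
    for the values of the second fundamental form on it, and let a dot denote
    the scalar product.  Minimality says s11 = s22, so everything is carried by
    u = s11 + s12 and v = s11 - s12; up to the factor 2 these are the values
    of the second fundamental form on the null vectors X1 + X2 and X1 - X2.

    The Gauss equation gives K = s12.s12 - s11.s22 = - u.v.  The Ricci equation
    gives, up to sign, kappa = 2 det (s11, s12), where the determinant refers
    to an orthonormal normal frame; the normal plane has signature (1,1), so
    the square of this is (u.v)^2 - (u.u)(v.v).  Hence
      K^2 - kappa^2 = (u.u)(v.v)                    ([curvature_null]).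
    Both equations come from one identity, [structure_equation]: for vector
    fields e1, e2 along the surface the exterior derivative of the 1-form
    de2 . e1 is de1 ^ de2.  For an orthonormal tangent frame that form is the
    connection form of the Levi-Civita connection ([levi_civita_push] is the
    Koszul formula that links Christoffel symbols to tangential projection),
    and for an orthonormal normal frame it is that of the normal connection.

    In isothermal coordinates the normal part of Phi' is s_uu + j s_uv, so the
    real part plus, respectively minus, the j-part of its square is the square
    of s_uu + s_uv, respectively of s_uu - s_uv.  The coordinate frame arises
    from (X1, X2) by a hyperbolic rotation, a scaling and possibly a
    reflection; such a change preserves or exchanges the two null directions
    ([II_minimal_change]).  So the two numbers are positive multiples of u.u
    and v.v in one order or the other ([dPhi_perp_sq_null]): the square has
    norm zero iff (u.u)(v.v) = 0, it lies in D_+ or in - D_+ iff u.u and v.v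
    are both positive or both negative, and it lies in j D_+ or in - j D_+ iff
    they have opposite signs.  All assertions follow pointwise, except that the
    first and the second type must not both occur on a surface: u.u and v.v
    are continuous along a local frame and the domain is connected.

    The implications that start from the curvatures need isothermal
    coordinates around every point.  On a minimal surface the function
    h = a.x is harmonic for every constant vector a, that is, the Hodge dual
    of dh is closed ([conj_form_closed]); with a local primitive y of it
    ([closed_form_primitive]), the pair (h, y) is isothermal wherever h has
    a time-like gradient ([isothermal_exists]). *)

(* Comparing two distinct derivatives must fail at once instead of unfolding
   the limits that define them. *)
Local Opaque derive.

(** * Smooth maps on the parameter plane *)

Lemma ord2P (i : 'I_2) : i = 0 \/ i = 1.
Proof. by case: i => -[|[|//]] i2; [left|right]; apply/val_inj. Qed.

Lemma sum_ord2 (V : nmodType) (F : 'I_2 -> V) : \sum_i F i = F 0 + F 1.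
Proof.
rewrite 2!big_ord_recl big_ord0 addr0.
by have -> : lift ord0 (ord0 : 'I_1) = 1 by apply/val_inj.
Qed.

Section Calculus.
Variable R : realType.
Local Notation plane := 'rV[R]_2.
Implicit Types (q v : plane) (U : set plane).

(** The form of differentiability in which an explicit error estimate gives it. *)
Lemma is_diff_littleo (V W : normedModType R) (f : V -> W)
    (df : {linear V -> W}) (x : V) : continuous df ->
  (forall e, 0 < e ->
     \forall h \near (0 : V), `|f (h + x) - f x - df h| <= e * `|h|) ->
  is_diff x f df.
Proof.
move=> dfc fx.
have fo : f \o shift x = cst (f x) + df +o_ 0 id.
  apply/eqaddoP => e e0; have := fx e e0; apply: filterS => h.
  by rewrite /= !fctE /= opprD addrA.
have dfE := diff_unique dfc fo.
by apply: DiffDef => //; apply/diff_locallyP; rewrite dfE.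
Qed.

Lemma near_shift0 (V : normedModType R) (q : V) (P : set V) :
  (\forall r \near q, P r) -> \forall h \near (0 : V), P (h + q).
Proof.
move=> /nbhs_ballP[e /= e0 eP]; apply/nbhs_ballP; exists e => //= h.
rewrite -ball_normE /ball_/= sub0r normrN => he; apply: eP.
by rewrite -ball_normE /ball_/= opprD addrCA subrr addr0 normrN.
Qed.

Lemma near_eq_differentiable (V W : normedModType R) (f g : V -> W) (q : V) :
  (\near q, f q = g q) -> differentiable f q -> differentiable g q.
Proof.
move=> fg df.
suff [] : is_diff q g ('d f q) by [].
apply: is_diff_littleo; first exact: diff_continuous.
move=> e e0.
have /eqaddoP/(_ e e0) := diff_locally df.
apply: filterS2 (near_shift0 fg) => h /= fgh.
by rewrite !fctE /= fgh (nbhs_singleton fg) opprD addrA.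
Qed.

Lemma differentiable_coords n (f : plane -> 'rV[R]_n) q :
  (forall j, differentiable (fun r => f r 0 j) q) -> differentiable f q.
Proof.
move=> df.
have -> : f = \sum_(j < n) (fun r => f r 0 j *: (delta_mx 0 j : 'rV[R]_n)).
  apply/funext => r; rewrite fct_sumE [LHS]row_sum_delta.
  by [].
apply: differentiable_sum => j; exact: differentiableZl.
Qed.

Lemma differentiable_coordE n (f : plane -> 'rV[R]_n) q j :
  differentiable f q -> differentiable (fun r => f r 0 j) q.
Proof.
move=> df; apply: (differentiable_comp (g := fun N : 'rV[R]_n => N 0 j)) => //.
exact: differentiable_coord.
Qed.

Lemma derive_coord n (f : plane -> 'rV[R]_n) q v j :
  differentiable f q -> ('D_v f q) 0 j = 'D_v (fun r => f r 0 j) q.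
Proof.
by move=> df; rewrite derive_mx ?mxE//; exact: diff_derivable.
Qed.

Lemma derive_pd (W : normedModType R) (f : plane -> W) q v :
  differentiable f q -> 'D_v f q = \sum_i v 0 i *: pd i f q.
Proof.
move=> df; rewrite deriveE// {1}[v]row_sum_delta linear_sum.
by apply: eq_bigr => i _; rewrite linearZ /pd deriveE.
Qed.

Lemma pd_near (W : normedModType R) i (f g : plane -> W) q :
  (\near q, f q = g q) -> pd i f q = pd i g q.
Proof. exact: near_eq_derive. Qed.

Lemma open_eq_near (T : Type) U (f g : plane -> T) q :
  open U -> U q -> (forall r, U r -> f r = g r) -> \near q, f q = g q.
Proof.
by move=> oU Uq fg; apply: filterS fg _; exact: open_nbhs_nbhs.
Qed.

Lemma derive_comp_affine (W : normedModType R) (f : plane -> W) (a v : plane)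
    (s : R) : differentiable f (a + s *: v) ->
  is_derive s 1 (fun t : R => f (a + t *: v)) ('D_v f (a + s *: v)).
Proof.
move=> df.
pose l := fun t : R => a + t *: v.
have dl : is_diff s l (fun t => t *: v).
  rewrite /l; apply: is_diff_eq.
  by apply/funext => t; rewrite add0r.
have dfl : differentiable (f \o l) s by apply: differentiable_comp.
apply: DeriveDef; first exact: diff_derivable.
rewrite (deriveE _ dfl) diff_comp//= diff_val scale1r.
by rewrite deriveE.
Qed.

Lemma MVT_segment_plane (f : plane -> R) (a v : plane) :
  (forall s : R, 0 <= s <= 1 -> differentiable f (a + s *: v)) ->
  exists2 s : R, 0 < s < 1 & f (a + v) - f a = 'D_v f (a + s *: v).
Proof.
move=> df.
have [| |s] := @MVT R (fun t => f (a + t *: v)) (fun t => 'D_v f (a + t *: v))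
  0 1 ltr01.
- move=> s; rewrite in_itv/= => /andP[s0 s1].
  by apply: derive_comp_affine; apply: df; rewrite !ltW.
- apply: derivable_within_continuous => s; rewrite in_itv/= => s01.
  by have [] := derive_comp_affine (df s s01).
- rewrite in_itv/= scale1r scale0r addr0 subr0 mulr1 => s01 ->.
  by exists s.
Qed.

Lemma smooth_on_differentiable (W : normedModType R) U (f : plane -> W) q :
  smooth_on U f -> U q -> differentiable f q.
Proof. by move=> fs; exact: (fs [::]). Qed.

Lemma smooth_on_pd (W : normedModType R) U (f : plane -> W) i :
  smooth_on U f -> smooth_on U (pd i f).
Proof. by move=> fs s q Uq; rewrite -foldr_rcons; exact: fs. Qed.

Lemma smooth_onS (W : normedModType R) (U V : set plane) (f : plane -> W) :
  V `<=` U -> smooth_on U f -> smooth_on V f.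
Proof. by move=> VU fs s q /VU; exact: fs. Qed.

(** Coinduction: a class of functions that are differentiable and whose partial
    derivatives belong, on the open set, to the class again consists of smooth
    functions.  This spares an induction on the order of differentiation in
    every closure property. *)
Lemma smooth_on_coind (W : normedModType R) U (P : (plane -> W) -> Prop) :
  open U ->
  (forall f q, P f -> U q -> differentiable f q) ->
  (forall f i, P f -> exists2 g, P g & forall q, U q -> pd i f q = g q) ->
  forall f, P f -> smooth_on U f.
Proof.
move=> oU Pd Ppd f Pf s.
have [g Pg fg] : exists2 g, P g & forall q, U q -> foldr (@pd R W) f s q = g q.
  elim: s => [|i s [g Pg fg]]; first by exists f.
  have [g' Pg' gg'] := Ppd g i Pg; exists g' => // q Uq /=.
  rewrite -gg'//; apply: pd_near; exact: open_eq_near fg.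
move=> q Uq; apply: (near_eq_differentiable (f := g)); last exact: Pd.
by apply: (open_eq_near oU Uq) => r Ur; rewrite fg.
Qed.

Lemma smooth_on_ext (W : normedModType R) U (f g : plane -> W) :
  open U -> (forall q, U q -> f q = g q) -> smooth_on U f -> smooth_on U g.
Proof.
move=> oU fg fs.
apply: (@smooth_on_coind _ U
  (fun g => exists2 f, smooth_on U f & forall q, U q -> f q = g q)) => //.
- move=> h q [f' fs' fg'] Uq.
  apply: near_eq_differentiable (smooth_on_differentiable fs' Uq).
  exact: open_eq_near fg'.
- move=> h i [f' fs' fg']; exists (pd i f'); last first.
    by move=> q Uq; apply: pd_near; apply: (open_eq_near oU) => // r Ur; rewrite fg'.
  by exists (pd i f') => //; exact: smooth_on_pd.
by exists f.
Qed.

(** The algebra generated by the smooth functions; by the Leibniz rule it is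
    closed under partial derivatives, so that coinduction applies to it. *)
Inductive smooth_alg U : (plane -> R) -> Prop :=
| SmoothGen f of smooth_on U f : smooth_alg U f
| SmoothCst c : smooth_alg U (cst c)
| SmoothD f g of smooth_alg U f & smooth_alg U g : smooth_alg U (f + g)
| SmoothM f g of smooth_alg U f & smooth_alg U g : smooth_alg U (f * g).

Lemma smooth_algP U (f : plane -> R) : open U -> smooth_alg U f -> smooth_on U f.
Proof.
move=> oU; move: f.
have algd : forall f q, smooth_alg U f -> U q -> differentiable f q.
  move=> f q + Uq; elim=> [g gs|c|g h _ dg _ dh|g h _ dg _ dh].
  - exact: smooth_on_differentiable gs Uq.
  - exact: differentiable_cst.
  - exact: differentiableD.
  - exact: differentiableM.
apply: smooth_on_coind => // f i.
elim=> [g gs|c|g h Pg [g' Pg' gg'] Ph [h' Ph' hh']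
  |g h Pg [g' Pg' gg'] Ph [h' Ph' hh']].
- by exists (pd i g) => //; apply: SmoothGen; exact: smooth_on_pd.
- by exists (cst 0); [exact: SmoothCst|move=> q _; exact: derive_cst].
- exists (g' + h'); first exact: SmoothD.
  move=> q Uq; rewrite /pd deriveD; last 2 first.
  + by apply: diff_derivable; exact: algd.
  + by apply: diff_derivable; exact: algd.
  by rewrite !fctE -gg'// -hh'.
- exists (g * h' + h * g').
    by apply: SmoothD; exact: SmoothM.
  move=> q Uq; rewrite /pd deriveM; last 2 first.
  + by apply: diff_derivable; exact: algd.
  + by apply: diff_derivable; exact: algd.
  by rewrite !fctE -gg'// -hh'.
Qed.

Lemma smooth_onD U (f g : plane -> R) : open U ->
  smooth_on U f -> smooth_on U g -> smooth_on U (fun q => f q + g q).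
Proof.
by move=> oU fs gs; apply: smooth_algP => //; apply: SmoothD; exact: SmoothGen.
Qed.

Lemma smooth_onM U (f g : plane -> R) : open U ->
  smooth_on U f -> smooth_on U g -> smooth_on U (fun q => f q * g q).
Proof.
by move=> oU fs gs; apply: smooth_algP => //; apply: SmoothM; exact: SmoothGen.
Qed.

Lemma smooth_on_cst U (c : R) : open U -> smooth_on U (fun _ : plane => c).
Proof. by move=> oU; apply: smooth_algP => //; exact: SmoothCst. Qed.

Lemma smooth_onN U (f : plane -> R) : open U ->
  smooth_on U f -> smooth_on U (fun q => - f q).
Proof.
move=> oU fs; have -> : (fun q => - f q) = (fun q => (-1) * f q).
  by apply/funext => q; rewrite mulN1r.
by apply: smooth_onM => //; exact: smooth_on_cst.
Qed.

Lemma smooth_on_sum U n (f : 'I_n -> plane -> R) : open U ->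
  (forall i, smooth_on U (f i)) -> smooth_on U (fun q => \sum_i f i q).
Proof.
move=> oU fs; have -> : (fun q => \sum_i f i q) = \sum_i f i :> (plane -> R).
  by apply/funext => q; rewrite fct_sumE.
elim/big_ind: _ => // [|g h gs hs]; last exact: smooth_onD.
exact: smooth_on_cst.
Qed.

Lemma smooth_on_coord U n (f : plane -> 'rV[R]_n) j : open U ->
  smooth_on U f -> smooth_on U (fun q => f q 0 j : R).
Proof.
move=> oU fs; apply: (@smooth_on_coind _ U
  (fun g => exists2 f : plane -> 'rV[R]_n, smooth_on U f & g = fun q => f q 0 j))
  => //.
- move=> _ q [f' fs' ->] Uq.
  by apply: differentiable_coordE; exact: smooth_on_differentiable fs' Uq.
- move=> _ i [f' fs' ->]; exists (fun q => pd i f' q 0 j).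
    by exists (pd i f') => //; exact: smooth_on_pd.
  by move=> q Uq; rewrite /pd derive_coord//; exact: smooth_on_differentiable fs' Uq.
by exists f.
Qed.

Lemma smooth_on_coords U n (f : plane -> 'rV[R]_n) : open U ->
  (forall j, smooth_on U (fun q => f q 0 j : R)) -> smooth_on U f.
Proof.
move=> oU; move: f.
have dP (f : plane -> 'rV[R]_n) q : (forall j, smooth_on U (fun q => f q 0 j : R)) -> U q ->
    differentiable f q.
  move=> fs Uq; apply: differentiable_coords => j.
  exact: smooth_on_differentiable (fs j) Uq.
apply: smooth_on_coind => // f i fs; exists (pd i f) => // j.
have := smooth_on_pd i (fs j); apply: smooth_on_ext => // q Uq.
by rewrite /pd derive_coord//; exact: dP.
Qed.

(** * Symmetry of second derivatives *)

Lemma derive_translate (W : normedModType R) (f : plane -> W) (q c : plane) :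
  differentiable f (q + c) ->
  differentiable (fun r => f (r + c)) q /\
  forall v, 'D_v (fun r => f (r + c)) q = 'D_v f (q + c).
Proof.
move=> df; have dl : is_diff q (fun r : plane => r + c) id.
  by apply: is_diff_eq; rewrite addr0.
have dfl : differentiable (f \o (fun r => r + c)) q by apply: differentiable_comp.
split=> // v; rewrite deriveE// [LHS](_ : _ = 'd (f \o (fun r => r + c)) q v)//.
by rewrite diff_comp//= diff_val -deriveE.
Qed.

(** The mean value theorem in the direction v and differentiability of the
    derivative along v compare the second difference with only one of the two
    mixed derivatives; exchanging v and w compares it with the other. *)
Lemma second_difference (f : plane -> R) (q v w : plane) :
  (\near q, differentiable f q) -> differentiable ('D_v f) q ->
  forall e, 0 < e -> exists2 d, 0 < d & forall h, 0 < h < d ->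
  `|f (q + h *: v + h *: w) - f (q + h *: v) - f (q + h *: w) + f q
    - h ^+ 2 * 'D_w ('D_v f) q| <= e * h ^+ 2.
Proof.
pose F := 'D_v f; rewrite -/F => ndf dF e e0.
(* The 1 keeps C positive when v and w vanish. *)
set C := `|v| + `|w| + 1.
have C0 : 0 < C by rewrite ltr_wpDl// addr_ge0.
pose e' := e / (2 * C).
have e'0 : 0 < e' by rewrite divr_gt0// mulr_gt0.
have /eqaddoP/(_ e' e'0) Fo := diff_locally dF.
have /nbhs_ballP[d /= d0 dP] :
    \forall k \near (0:plane), differentiable f (k + q) /\
    `|F (k + q) - F q - 'd F q k| <= e' * `|k|.
  apply: filterS2 (near_shift0 ndf) Fo => k /= dk.
  by rewrite !fctE /= opprD addrA.
have {}dP k : `|k| < d -> differentiable f (q + k) /\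
    `|F (q + k) - F q - 'd F q k| <= e' * `|k|.
  move=> kd; rewrite (addrC q); apply: dP.
  by rewrite -ball_normE /ball_/= sub0r normrN.
exists (d / C) => [|h /andP[h0 hd]]; first exact: divr_gt0.
have hCd : h * C < d by rewrite -ltr_pdivlMr.
have small s b : 0 <= s <= 1 -> 0 <= b <= 1 ->
    `|s *: (h *: v) + (b * h) *: w| <= h * C.
  move=> /andP[s0 s1] /andP[b0 b1]; apply: (le_trans (ler_normD _ _)).
  rewrite !normrZ !(ger0_norm s0) (ger0_norm b0) (gtr0_norm h0) /C !mulrDr mulr1.
  rewrite -[leLHS]addr0; apply: lerD (ltW h0); apply: lerD.
    by rewrite ler_piMl// mulr_ge0// ltW.
  by rewrite -mulrA ler_piMl// mulr_ge0// ltW.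
pose g r := f (r + h *: w) - f r.
have dg s : 0 <= s <= 1 -> differentiable g (q + s *: (h *: v)) /\
   forall u, 'D_u g (q + s *: (h *: v)) =
     'D_u f (q + s *: (h *: v) + h *: w) - 'D_u f (q + s *: (h *: v)).
  move=> s01.
  have [|df0 _] := dP (s *: (h *: v)).
    have := small s 0 s01; rewrite mul0r scale0r addr0 lexx ler01 => /(_ isT).
    by move=> /le_lt_trans; exact.
  have [|df1 _] := dP (s *: (h *: v) + h *: w).
    have := small s 1 s01; rewrite mul1r lexx ler01 => /(_ isT).
    by move=> /le_lt_trans; exact.
  move: df1; rewrite addrA => /derive_translate[df1 Df1].
  split; first exact: differentiableB.
  move=> u; rewrite deriveB; [|exact: diff_derivable..].
  by rewrite Df1.
have [s s01|s /andP[s0 s1]] := @MVT_segment_plane g q (h *: v).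
  by have [] := dg s s01.
have s01 : 0 <= s <= 1 by rewrite !ltW.
have [_ ->] := dg s s01.
have [|df0 Fo0] := dP (s *: (h *: v)).
  have := small s 0 s01; rewrite mul0r scale0r addr0 lexx ler01 => /(_ isT).
  by move=> /le_lt_trans; exact.
have [|df1 Fo1] := dP (s *: (h *: v) + h *: w).
  have := small s 1 s01; rewrite mul1r lexx ler01 => /(_ isT).
  by move=> /le_lt_trans; exact.
have DhF r : differentiable f r -> 'D_(h *: v) f r = h * F r.
  by move=> dfr; rewrite /F !deriveE// linearZ.
rewrite -(addrA q (s *: _)) (DhF _ df1) (DhF _ df0) /g => gE.
have -> : f (q + h *: v + h *: w) - f (q + h *: v) - f (q + h *: w) + f q =
   h * F (q + (s *: (h *: v) + h *: w)) - h * F (q + s *: (h *: v)).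
  by rewrite -gE; ring.
rewrite (deriveE _ dF).
have -> : h * F (q + (s *: (h *: v) + h *: w)) - h * F (q + s *: (h *: v)) -
    h ^+ 2 * 'd F q w =
  h * ((F (q + (s *: (h *: v) + h *: w)) - F q - 'd F q (s *: (h *: v) + h *: w))
      - (F (q + s *: (h *: v)) - F q - 'd F q (s *: (h *: v)))).
  rewrite linearD [X in _ = _ * (_ - (_ + X) - _)]linearZ /= /GRing.scale/=.
  set z := 'd F q (s *: _); set y := 'd F q w; ring.
rewrite normrM (gtr0_norm h0) expr2 mulrCA ler_pM2l//.
apply: (le_trans (ler_normB _ _)); apply: (le_trans (lerD Fo1 Fo0)).
rewrite -mulrDr.
have := small s 0 s01; rewrite mul0r scale0r addr0 lexx ler01 => /(_ isT) k0.
have := small s 1 s01; rewrite mul1r lexx ler01 => /(_ isT) k1.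
apply: (@le_trans _ _ (e' * (h * C + h * C))).
  by rewrite ler_pM2l// lerD.
by rewrite /e' le_eqVlt; apply/orP; left; apply/eqP; field; rewrite lt0r_neq0.
Qed.

(** Schwarz: the second difference is symmetric in the two directions, so both
    mixed derivatives are its limit after division by h^2. *)
Lemma pdC U (f : plane -> R) q i j : open U -> smooth_on U f -> U q ->
  pd i (pd j f) q = pd j (pd i f) q.
Proof.
move=> oU fs Uq.
have ndf : \near q, differentiable f q.
  apply: filterS (open_nbhs_nbhs (conj oU Uq)) => r Ur.
  exact: smooth_on_differentiable fs Ur.
have dpd k : differentiable (pd k f) q.
  exact: smooth_on_differentiable (smooth_on_pd k fs) Uq.
apply/eqP; rewrite -subr_eq0 -normr_le0; apply/ler_addgt0Pr => e e0.
rewrite add0r.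
have e2 : 0 < e / 2 by rewrite divr_gt0.
have [d1 d10 D1] := second_difference (v := delta_mx 0 i) (delta_mx 0 j) ndf (dpd i) e2.
have [d2 d20 D2] := second_difference (v := delta_mx 0 j) (delta_mx 0 i) ndf (dpd j) e2.
pose h := Num.min d1 d2 / 2.
have m0 : 0 < Num.min d1 d2 by rewrite lt_min d10.
have h0 : 0 < h by rewrite divr_gt0.
have hm : h < Num.min d1 d2 by rewrite /h gtr_pMr// invf_lt1// ltr1n.
move: (hm); rewrite lt_min => /andP[hd1 hd2].
have := D1 h; rewrite h0 hd1 => /(_ isT); have := D2 h; rewrite h0 hd2 => /(_ isT).
rewrite -/(pd i f) -/(pd j f).
set A := pd i (pd j f) q; set B := pd j (pd i f) q.
rewrite [q + h *: _ + _]addrAC.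
set a := f _; set b := f _; set c := f (q + _); set d := f q.
move=> E2 E1.
have h2 : 0 < h ^+ 2 by rewrite exprn_gt0.
rewrite -(ler_pM2l h2) -[X in X * `|_|](gtr0_norm h2) -normrM.
have -> : h ^+ 2 * (A - B) =
    (a - c - b + d - h ^+ 2 * B) - (a - b - c + d - h ^+ 2 * A).
  by move: (h) (a) (b) (c) (d) (A) (B); clear => *; ring.
apply: (le_trans (ler_normB _ _)).
apply: (le_trans (lerD E1 E2)); rewrite le_eqVlt; apply/orP; left; apply/eqP.
by move: (h) (e); clear => *; field.
Qed.

End Calculus.

(** * Primitives of closed 1-forms *)

Section Poincare.
Variable R : realType.
Local Notation plane := 'rV[R]_2.
Local Notation mu := (@lebesgue_measure R).
Implicit Types (p q : plane) (U V : set plane) (s t : R).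

Definition pt s t : plane := \row_i if i == 0 then s else t.

Lemma pt0 s t : pt s t 0 0 = s. Proof. by rewrite mxE. Qed.
Lemma pt1 s t : pt s t 0 1 = t. Proof. by rewrite mxE. Qed.
Lemma ptE q : pt (q 0 0) (q 0 1) = q.
Proof. by apply/rowP => i; rewrite mxE; have [->|->] := ord2P i. Qed.

Lemma is_derive_pt0 (f : plane -> R) s t : differentiable f (pt s t) ->
  is_derive s 1 (fun s' => f (pt s' t)) (pd 0 f (pt s t)).
Proof.
have E s' : pt s' t = pt 0 t + s' *: delta_mx 0 0.
  by apply/rowP => i; rewrite !mxE; have [->|->] := ord2P i; rewrite /= ?mulr1 ?mulr0 ?addr0 ?add0r.
have -> : (fun s' => f (pt s' t)) = (fun s' => f (pt 0 t + s' *: delta_mx 0 0)).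
  by apply/funext => s'; rewrite E.
rewrite E => df; exact: derive_comp_affine df.
Qed.

Lemma is_derive_pt1 (f : plane -> R) s t : differentiable f (pt s t) ->
  is_derive t 1 (fun t' => f (pt s t')) (pd 1 f (pt s t)).
Proof.
have E t' : pt s t' = pt s 0 + t' *: delta_mx 0 1.
  by apply/rowP => i; rewrite !mxE; have [->|->] := ord2P i; rewrite /= ?mulr1 ?mulr0 ?addr0 ?add0r.
have -> : (fun t' => f (pt s t')) = (fun t' => f (pt s 0 + t' *: delta_mx 0 1)).
  by apply/funext => t'; rewrite E.
rewrite E => df; exact: derive_comp_affine df.
Qed.

Lemma is_derive_continuous (f : R -> R) s (d : R) : is_derive s 1 f d ->
  {for s, continuous f}.
Proof.
by move=> [df _]; apply: differentiable_continuous; exact/derivable1_diffP.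
Qed.

Lemma segment_integrable (f : R -> R) (a b : R) :
  (forall s, a <= s <= b -> {for s, continuous f}) ->
  mu.-integrable `[a, b] (EFin \o f).
Proof.
move=> cf; apply: continuous_compact_integrable; first exact: segment_compact.
apply: continuous_in_subspaceT => s; rewrite inE/= in_itv/=; exact: cf.
Qed.

Lemma FTC1_segment (f : R -> R) (a b s : R) :
  (forall s, a <= s <= b -> {for s, continuous f}) -> a < s < b ->
  is_derive s 1 (fun s' => \int[mu]_(t in `[a, s']) f t)%R (f s).
Proof.
move=> cf /andP[sa sb].
have [] := @continuous_FTC1_closed R f a s b sb (segment_integrable cf) sa.
  by apply: cf; rewrite !ltW.
move=> dF; rewrite derive1E => Fs; exact (DeriveDef dF Fs).
Qed.

Lemma FTC2_segment (f F : R -> R) (a b : R) : a < b ->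
  (forall s, a <= s <= b -> {for s, continuous f}) ->
  (forall s, a <= s <= b -> is_derive s 1 F (f s)) ->
  (\int[mu]_(t in `[a, b]) f t)%R = F b - F a.
Proof.
move=> ab cf dF; rewrite /Rintegral (@continuous_FTC2 _ f F)//.
- by apply: continuous_in_subspaceT => s; rewrite inE/= in_itv/=; exact: cf.
- split.
  + move=> s; rewrite in_itv/= => /andP[s1 s2].
    by have [] := dF s; rewrite ?ltW// !ltW.
  + apply: cvg_at_right_filter.
    by apply: (is_derive_continuous (dF a _)); rewrite lexx ltW.
  + apply: cvg_at_left_filter.
    by apply: (is_derive_continuous (dF b _)); rewrite lexx ltW.
- move=> s; rewrite in_itv/= => /andP[s1 s2].
  rewrite derive1E; have H : is_derive s 1 F (f s) by apply: dF; rewrite !ltW.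
  by rewrite derive_val.
Qed.

Section Box.
Variables (U : set plane) (P Q : plane -> R).
Hypotheses (sP : smooth_on U P) (sQ : smooth_on U Q).
Hypothesis clPQ : forall q, U q -> pd 1 P q = pd 0 Q q.
Variables (l0 h0 l1 h1 : R).
Hypothesis lh1 : l1 < h1.
Hypothesis box : forall s t, l0 <= s <= h0 -> l1 <= t <= h1 -> U (pt s t).

(** Integration along the lower edge of the box, then upwards. *)
Definition box_primitive s t : R :=
  (\int[mu]_(s' in `[l0, s]) P (pt s' l1) + \int[mu]_(t' in `[l1, t]) Q (pt s t'))%R.

Let cont0 (f : plane -> R) s t : smooth_on U f -> l0 <= s <= h0 -> l1 <= t <= h1 ->
  {for s, continuous (fun s' => f (pt s' t))}.
Proof.
move=> sf s01 t01; apply: is_derive_continuous (is_derive_pt0 _).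
exact: smooth_on_differentiable sf (box s01 t01).
Qed.

Let cont1 (f : plane -> R) s t : smooth_on U f -> l0 <= s <= h0 -> l1 <= t <= h1 ->
  {for t, continuous (fun t' => f (pt s t'))}.
Proof.
move=> sf s01 t01; apply: is_derive_continuous (is_derive_pt1 _).
exact: smooth_on_differentiable sf (box s01 t01).
Qed.

Lemma box_primitive_d1 s t : l0 < s < h0 -> l1 < t < h1 ->
  is_derive t 1 (box_primitive s) (Q (pt s t)).
Proof.
move=> s01 t01; rewrite /box_primitive.
have s01' : l0 <= s <= h0 by case/andP: s01 => *; rewrite !ltW.
have H := FTC1_segment (fun t' t01' => cont1 sQ s01' t01') t01.
rewrite -[Q _]add0r; exact (is_deriveD (is_derive_cst _ _ _) H).
Qed.

(** A dominating constant for differentiation under the integral sign. *)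
Lemma box_bounded (f : plane -> R) : smooth_on U f ->
  exists2 M, 0 <= M & forall s t, l0 <= s <= h0 -> l1 <= t <= h1 -> `|f (pt s t)| <= M.
Proof.
move=> sf.
pose lo (i : 'I_2) := if i == 0 then l0 else l1.
pose hi (i : 'I_2) := if i == 0 then h0 else h1.
pose B : set plane := [set v | forall i, `[lo i, hi i]%classic (v 0 i)].
have cB : compact B.
  by apply: (@rV_compact _ _ (fun i => `[lo i, hi i]%classic)) => i; exact: segment_compact.
have BU v : B v -> U v.
  move=> Bv; rewrite -(ptE v); apply: box.
    by have := Bv 0; rewrite /lo /hi /= in_itv.
  by have := Bv 1; rewrite /lo /hi /= in_itv.
have cf : {within B, continuous f}.
  apply: continuous_in_subspaceT => v; rewrite inE => /BU Uv.
  exact: differentiable_continuous (smooth_on_differentiable sf Uv).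
have /compact_bounded[M [_ MB]] := continuous_compact cf cB.
(* The bound holds for every number greater than M; it must be nonnegative. *)
exists (`|M| + 1); first by rewrite addr_ge0.
move=> s t s01 t01; apply: (MB (`|M| + 1)); first by rewrite ltr_pwDr// ler_norm.
exists (pt s t) => // i; rewrite /lo /hi /=.
by have [->|->] := ord2P i; rewrite ?pt0 ?pt1 /= in_itv.
Qed.

(** Under the second integral sign the derivative of Q is that of P in the other
    variable, because the form is closed; integrating it back replaces the value of
    P on the lower edge by its value at the upper end. *)
Lemma box_primitive_d0 s t : l0 < s < h0 -> l1 < t < h1 ->
  is_derive s 1 (fun s' => box_primitive s' t) (P (pt s t)).
Proof.
move=> s01 /andP[lt th]; rewrite /box_primitive.
have s01' : l0 <= s <= h0 by case/andP: s01 => *; rewrite !ltW.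
have l1h : l1 <= l1 <= h1 by rewrite lexx ltW.
have H1 := FTC1_segment (fun s' s01' => cont0 sP s01' l1h) s01.
have tle t' : l1 <= t' <= t -> l1 <= t' <= h1.
  by move=> /andP[-> /le_trans]; apply; exact: ltW.
have wI s' : `]l0, h0[%classic s' -> l0 <= s' <= h0.
  by rewrite /= in_itv/= => /andP[? ?]; rewrite !ltW.
have tB t' : `[l1, t]%classic t' -> l1 <= t' <= h1.
  by rewrite /= in_itv/=; exact: tle.
have Is : `]l0, h0[%classic s by rewrite /= in_itv.
have [M M0 MP] := box_bounded (smooth_on_pd 0 sQ).
have d1E s' t' : `]l0, h0[%classic s' -> `[l1, t]%classic t' ->
    is_derive s' 1 (fun s'' => Q (pt s'' t')) (pd 0 Q (pt s' t')).
  move=> /wI Is' /tB Bt'; apply: is_derive_pt0.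
  exact: smooth_on_differentiable sQ (box Is' Bt').
have intQ s' : `]l0, h0[%classic s' -> mu.-integrable `[l1, t] (EFin \o (fun t' => Q (pt s' t'))).
  move=> /wI Is'; apply: segment_integrable => t' /tle Bt'; exact: cont1.
have dQ s' t' : `]l0, h0[%classic s' -> `[l1, t]%classic t' ->
    derivable (fun s'' => Q (pt s'' t')) s' 1.
  by move=> Is' Bt'; have [] := d1E s' t' Is' Bt'.
have bQ s' t' : `]l0, h0[%classic s' -> `[l1, t]%classic t' ->
    `|partial1of2 (fun s'' t'' => Q (pt s'' t'')) s' t'| <= cst M t'.
  move=> Is' Bt'; rewrite partial1of2E.
  have := d1E s' t' Is' Bt' => H; rewrite derive_val.
  by apply: MP; [exact: wI|exact: tB].
have intM : mu.-integrable `[l1, t] (EFin \o cst M).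
  by apply: segment_integrable => t' _; exact: cst_continuous.
have mI : measurable (`[l1, t]%classic : set (measurableTypeR R)) by exact: measurable_itv.
have D1 := @derivable_under_integral R _ (measurableTypeR R) mu
  (fun s' t' => Q (pt s' t')) _ mI s l0 h0 Is intQ dQ (cst M) (fun=> M0) intM bQ.
have D2 := @differentiation_under_integral R _ (measurableTypeR R) mu
  (fun s' t' => Q (pt s' t')) _ mI s l0 h0 Is intQ dQ (cst M) (fun=> M0) intM bQ.
(* Closedness turns the derivative of Q into that of P. *)
have D3 : (\int[mu]_(t' in `[l1, t]) partial1of2 (fun s'' t'' => Q (pt s'' t'')) s t')%R =
    P (pt s t) - P (pt s l1).
  have c1 t' : l1 <= t' <= t -> {for t', continuous (fun t' => pd 1 P (pt s t'))}.
    by move=> /tle Bt'; apply: cont1 => //; exact: smooth_on_pd.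
  have e1 t' : l1 <= t' <= t -> is_derive t' 1 (fun t' => P (pt s t')) (pd 1 P (pt s t')).
    move=> /tle Bt'; apply: is_derive_pt1.
    exact: smooth_on_differentiable sP (box s01' Bt').
  apply: etrans (FTC2_segment lt c1 e1).
  apply: eq_Rintegral => t' /[!inE] Bt'; rewrite partial1of2E.
  have := d1E s t' Is Bt' => H; rewrite derive_val clPQ//.
  by apply: box => //; exact: tB.
rewrite D3 derive1E in D2.
rewrite -[P (pt s t)](subrK (P (pt s l1))) addrC.
exact (is_deriveD H1 (DeriveDef D1 D2)).
Qed.

End Box.

(** The mean value theorem without assuming which endpoint is the smaller one. *)
Lemma MVT_near (f df : R -> R) (a b : R) :
  (forall s, `|s - a| <= `|b - a| -> is_derive s 1 f (df s)) ->
  exists2 c, `|c - a| <= `|b - a| & f b - f a = df c * (b - a).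
Proof.
move=> dF.
have [ab|ba|->] := ltgtP a b; last by exists b; rewrite ?lexx// !subrr mulr0.
- have inab s : s \in `[a, b] -> `|s - a| <= `|b - a|.
    rewrite in_itv/= => /andP[as_ sb].
    by rewrite !ger0_norm ?subr_ge0 ?(ltW ab)// lerD2r.
  have [s /subset_itv_oo_cc sab||c /subset_itv_oo_cc cab E] := @MVT R f df a b ab.
  + exact/dF/inab.
  + by apply: derivable_within_continuous => s /inab /dF [].
  + by exists c => //; exact: inab.
- have inab s : s \in `[b, a] -> `|s - a| <= `|b - a|.
    rewrite in_itv/= => /andP[bs sa].
    by rewrite !ler0_norm ?subr_le0 ?(ltW ba)// lerN2 lerD2r.
  have [s /subset_itv_oo_cc sab||c /subset_itv_oo_cc cab E] := @MVT R f df b a ba.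
  + exact/dF/inab.
  + by apply: derivable_within_continuous => s /inab /dF [].
  + exists c => //; first exact: inab.
    by rewrite -opprB E -mulrN opprB.
Qed.

Lemma coord_le_norm (h : plane) i : `|h 0 i| <= `|h|.
Proof.
rewrite [leRHS]/Num.Def.normr/= mx_normrE.
exact: (le_bigmax _ (fun ij : 'I_1 * 'I_2 => `|h ij.1 ij.2|) (0, i)).
Qed.

Lemma norm_pt_le s t e : `|s| <= e -> `|t| <= e -> `|pt s t| <= e.
Proof.
move=> se te; rewrite [leLHS]/Num.Def.normr/= mx_normrE.
apply: bigmax_le => [|[i j] _ /=]; first exact: le_trans se.
by rewrite mxE; case: ifP.
Qed.

(** The increment is split into one step parallel to each axis; the mean value
    theorem turns each step into a value of a partial derivative near q, and these
    are continuous. *)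
Lemma partials_differentiable (Y : R -> R -> R) (P Q : plane -> R) V q :
  open V -> V q ->
  (forall r, V r -> is_derive (r 0 0) 1 (fun s => Y s (r 0 1)) (P r)) ->
  (forall r, V r -> is_derive (r 0 1) 1 (Y (r 0 0)) (Q r)) ->
  {for q, continuous P} -> {for q, continuous Q} ->
  let y (r : plane) := Y (r 0 0) (r 0 1) in
  [/\ differentiable y q, pd 0 y q = P q & pd 1 y q = Q q].
Proof.
move=> oV Vq dP dQ cP cQ y.
pose df0 (h : plane) : R := P q * h 0 0 + Q q * h 0 1.
have dflin : linear df0.
  by move=> k a b; rewrite /df0 !mxE /GRing.scale /=; ring.
pose dfM := GRing.isLinear.Build _ _ _ _ _ dflin.
pose df : {linear plane -> R} := HB.pack df0 dfM.
have dfc : continuous df.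
  move=> h; apply: (@continuousD _ _ _ (fun h : plane => P q * h 0 0)
    (fun h : plane => Q q * h 0 1)); apply: continuousM => //;
    by [exact: cst_continuous|exact: coord_continuous].
have small e : 0 < e -> \forall h \near (0:plane), `|y (h + q) - y q - df h| <= e * `|h|.
  move=> e0; have e2 : 0 < e / 2 by rewrite divr_gt0.
  have nq : \forall r \near q, [/\ V r, `|P r - P q| <= e / 2 & `|Q r - Q q| <= e / 2].
    have nP : \forall r \near q, `|P r - P q| <= e / 2.
      by move/cvgrPdist_le : cP => /(_ _ e2); apply: filterS => r; rewrite distrC.
    have nQ : \forall r \near q, `|Q r - Q q| <= e / 2.
      by move/cvgrPdist_le : cQ => /(_ _ e2); apply: filterS => r; rewrite distrC.
    by apply: filterS3 (open_nbhs_nbhs (conj oV Vq)) nP nQ => r; split.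
  move/nbhs_ballP : nq => [d /= d0 dB].
  apply/nbhs_ballP; exists d => //= h; rewrite -ball_normE /ball_/= sub0r normrN => hd.
  have inB s t : `|s - q 0 0| <= `|h 0 0| -> `|t - q 0 1| <= `|h 0 1| ->
      [/\ V (pt s t), `|P (pt s t) - P q| <= e / 2 & `|Q (pt s t) - Q q| <= e / 2].
    move=> sh th; apply: dB; rewrite -ball_normE /ball_/= distrC.
    apply: le_lt_trans hd.
    have -> : pt s t - q = pt (s - q 0 0) (t - q 0 1).
      by apply/rowP => i; rewrite !mxE; have [->|->] := ord2P i.
    apply: norm_pt_le; first exact: le_trans sh (coord_le_norm _ _).
    exact: le_trans th (coord_le_norm _ _).
  set s0 := q 0 0 in inB *; set t0 := q 0 1 in inB *.
  have E0 : (h + q) 0 0 = s0 + h 0 0 by rewrite mxE addrC.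
  have E1 : (h + q) 0 1 = t0 + h 0 1 by rewrite mxE addrC.
  have sub0 : s0 + h 0 0 - s0 = h 0 0 by rewrite addrC addKr.
  have sub1 : t0 + h 0 1 - t0 = h 0 1 by rewrite addrC addKr.
  have [s|c0 hc0 M0] := @MVT_near (fun s => Y s (t0 + h 0 1))
      (fun s => P (pt s (t0 + h 0 1))) s0 (s0 + h 0 0).
    rewrite sub0 => sh; have [|Vm _ _] := inB s (t0 + h 0 1) sh; first by rewrite sub1.
    by have := dP _ Vm; rewrite pt0 pt1.
  have [t|c1 hc1 M1] := @MVT_near (Y s0) (fun t => Q (pt s0 t)) t0 (t0 + h 0 1).
    rewrite sub1 => th; have [|Vm _ _] := inB s0 t _ th; first by rewrite subrr normr0.
    by have := dQ _ Vm; rewrite pt0 pt1.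
  rewrite sub0 in hc0 M0; rewrite sub1 in hc1 M1.
  have [|_ Pe _] := inB c0 (t0 + h 0 1) hc0; first by rewrite sub1.
  have [|_ _ Qe] := inB s0 c1 _ hc1; first by rewrite subrr normr0.
  have -> : y (h + q) - y q - df h =
      (P (pt c0 (t0 + h 0 1)) - P q) * h 0 0 + (Q (pt s0 c1) - Q q) * h 0 1.
    rewrite /y E0 E1 -/s0 -/t0 /df /= /df0 !mulrBl -M0 -M1; ring.
  apply: le_trans (ler_normD _ _) _; rewrite !normrM (splitr e) mulrDl.
  by apply: lerD; apply: ler_pM => //; exact: coord_le_norm.
have [dy dyE] := is_diff_littleo dfc small.
split=> //; rewrite /pd deriveE// dyE /= /df0 !mxE /=.
  by rewrite mulr1 mulr0 addr0.
by rewrite mulr1 mulr0 add0r.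
Qed.

(** Poincare lemma.  The primitive is smooth because its partial derivatives are
    the coefficients of the form, which are smooth. *)
Lemma closed_form_primitive U (P Q : plane -> R) p : open U -> U p ->
  smooth_on U P -> smooth_on U Q -> (forall q, U q -> pd 1 P q = pd 0 Q q) ->
  exists V (y : plane -> R), [/\ open V, V p, V `<=` U, smooth_on V y &
    forall q, V q -> pd 0 y q = P q /\ pd 1 y q = Q q].
Proof.
move=> oU Up sP sQ clPQ.
have /nbhs_ballP[d /= d0 dU] : nbhs p U by exact: open_nbhs_nbhs.
pose r := d / 2.
have r0 : 0 < r by rewrite divr_gt0.
have rd : r < d by rewrite /r gtr_pMr// invf_lt1// ltr1n.
have box s t : p 0 0 - r <= s <= p 0 0 + r -> p 0 1 - r <= t <= p 0 1 + r -> U (pt s t).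
  move=> sr tr; apply: dU; rewrite -ball_normE /ball_/= distrC.
  apply: le_lt_trans rd.
  have -> : pt s t - p = pt (s - p 0 0) (t - p 0 1).
    by apply/rowP => i; rewrite !mxE; have [->|->] := ord2P i.
  by apply: norm_pt_le; rewrite ler_norml; lra.
pose V := ball p r.
have Vin q : V q -> p 0 0 - r < q 0 0 < p 0 0 + r /\ p 0 1 - r < q 0 1 < p 0 1 + r.
  rewrite /V -ball_normE /ball_/= => pq.
  have := le_lt_trans (coord_le_norm (p - q) 0) pq.
  have := le_lt_trans (coord_le_norm (p - q) 1) pq.
  by rewrite !mxE !ltr_norml; lra.
have VU : V `<=` U.
  by move=> q /Vin[/andP[? ?] /andP[? ?]]; rewrite -(ptE q); apply: box; rewrite !ltW.
pose Y := box_primitive P Q (p 0 0 - r) (p 0 1 - r).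
have pr i : p 0 i - r < p 0 i + r by lra.
exists V, (fun q : plane => Y (q 0 0) (q 0 1)).
have oV : open V by exact: ball_open.
have Vp : V p by exact: ballxx.
have main q : V q -> [/\ differentiable (fun q : plane => Y (q 0 0) (q 0 1)) q,
    pd 0 (fun q : plane => Y (q 0 0) (q 0 1)) q = P q &
    pd 1 (fun q : plane => Y (q 0 0) (q 0 1)) q = Q q].
  move=> Vq; apply: (partials_differentiable oV Vq).
  - move=> r' /Vin[r0' r1'].
    have := box_primitive_d0 sP sQ clPQ (pr 1) box r0' r1'.
    by rewrite ptE.
  - move=> r' /Vin[r0' r1'].
    have := box_primitive_d1 P sQ box r0' r1'.
    by rewrite ptE.
  - exact: differentiable_continuous (smooth_on_differentiable sP (VU _ Vq)).
  - exact: differentiable_continuous (smooth_on_differentiable sQ (VU _ Vq)).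
split => //; last by move=> q /main[].
apply: (@smooth_on_coind _ _ V (fun f => f = (fun q : plane => Y (q 0 0) (q 0 1)) \/ smooth_on V f)) => //.
- move=> f q [->|sf] Vq; first by have [] := main q Vq.
  exact: smooth_on_differentiable sf Vq.
- move=> f i [->|sf]; last by exists (pd i f) => //; right; exact: smooth_on_pd.
  have [->|->] := ord2P i.
    exists P; first by right; exact: smooth_onS VU sP.
    by move=> q /main[].
  exists Q; first by right; exact: smooth_onS VU sQ.
  by move=> q /main[].
- by left.
Qed.

End Poincare.

(** * Local injectivity *)

Section LocalInjectivity.
Variable R : realType.
Local Notation plane := 'rV[R]_2.
Implicit Types (p q b c : plane) (U V : set plane).

(** The two rows of the Jacobian matrix are taken at different points b and c: the
    determinant is then a continuous function on the product, nonzero at (p, p). *)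
Lemma jacobian_near U (f g : plane -> R) p : open U -> U p ->
  smooth_on U f -> smooth_on U g ->
  pd 0 f p * pd 1 g p - pd 1 f p * pd 0 g p != 0 ->
  exists2 r, 0 < r & ball p r `<=` U /\
    forall b c, ball p r b -> ball p r c ->
    pd 0 f b * pd 1 g c - pd 1 f b * pd 0 g c != 0.
Proof.
move=> oU Up sf sg d0.
pose G (z : plane * plane) := pd 0 f z.1 * pd 1 g z.2 - pd 1 f z.1 * pd 0 g z.2.
have cpd h i : smooth_on U h -> {for p, continuous (pd i h : plane -> R)}.
  move=> sh; apply: differentiable_continuous.
  exact: smooth_on_differentiable (smooth_on_pd i sh) Up.
have c1 i : {for (p, p), continuous (fun z : plane * plane => pd i f z.1)}.
  by apply: continuous_comp; [exact: cvg_fst|exact: cpd].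
have c2 i : {for (p, p), continuous (fun z : plane * plane => pd i g z.2)}.
  by apply: continuous_comp; [exact: cvg_snd|exact: cpd].
have cG : {for (p, p), continuous G}.
  by apply: continuousB; apply: continuousM.
have nG : \forall z \near (p, p), G z != 0 by exact: (cvgr_neq0 _ cG).
case: nG => -[A B] /= [nA nB] AB.
have nABU : nbhs p (A `&` B `&` U).
  by apply: filterI; [exact: filterI|exact: open_nbhs_nbhs].
move/nbhs_ballP : nABU => [r /= r0 rP].
exists r => //; split=> [q /rP[]//|b c /rP[[Ab _] _] /rP[[_ Bc] _]].
exact: (AB (b, c)).
Qed.

(** If f and g agree at b and c, the mean value theorem gives two points of the
    segment at which df and dg vanish on c - b; as df at the first and dg at the
    second are independent, c = b. *)
Lemma jacobian_inj (f g : plane -> R) p r : 0 < r ->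
  (forall q, ball p r q -> differentiable f q) ->
  (forall q, ball p r q -> differentiable g q) ->
  (forall b c, ball p r b -> ball p r c ->
    pd 0 f b * pd 1 g c - pd 1 f b * pd 0 g c != 0) ->
  forall b c, ball p r b -> ball p r c -> f b = f c -> g b = g c -> b = c.
Proof.
move=> r0 df dg d0 b c Bb Bc fbc gbc.
have seg (s : R) : 0 <= s <= 1 -> ball p r (b + s *: (c - b)).
  move=> /andP[s0 s1]; move: Bb Bc; rewrite -!ball_normE /ball_/= => Bb Bc.
  have -> : p - (b + s *: (c - b)) = (1 - s) *: (p - b) + s *: (p - c).
    by apply/rowP => i; rewrite !mxE; ring.
  apply: le_lt_trans (ler_normD _ _) _; rewrite !normrZ.
  rewrite (ger0_norm s0) ger0_norm ?subr_ge0//.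
  have [-> |s1'] := eqVneq s 1; first by rewrite subrr mul0r add0r mul1r.
  have s1'' : 0 < 1 - s by rewrite subr_gt0 lt_neqAle s1' s1.
  have -> : r = (1 - s) * r + s * r by ring.
  by apply: ltr_leD; [rewrite ltr_pM2l|rewrite ler_wpM2l// ltW].
have E v : b + (v - b) = v by rewrite addrC subrK.
have [s s01|s /andP[s0 s1]] := @MVT_segment_plane R f b (c - b); first exact/df/seg.
rewrite E fbc subrr => /esym.
have Bs : ball p r (b + s *: (c - b)) by apply: seg; rewrite !ltW.
rewrite (derive_pd _ (df _ Bs)) sum_ord2 => Ef.
have [t t01|t /andP[t0 t1]] := @MVT_segment_plane R g b (c - b); first exact/dg/seg.
rewrite E gbc subrr => /esym.
have Bt : ball p r (b + t *: (c - b)) by apply: seg; rewrite !ltW.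
rewrite (derive_pd _ (dg _ Bt)) sum_ord2 => Eg.
have := d0 _ _ Bs Bt.
move: (pd 0 f _) (pd 1 f _) (pd 0 g _) (pd 1 g _) Ef Eg => f0 f1 g0 g1.
set w := c - b => Ef Eg det.
have {}Ef : w 0 0 * f0 + w 0 1 * f1 = 0 by exact: Ef.
have {}Eg : w 0 0 * g0 + w 0 1 * g1 = 0 by exact: Eg.
have w0 : w 0 0 = 0.
  apply: (mulfI det); rewrite mulr0.
  have -> : (f0 * g1 - f1 * g0) * w 0 0 =
    (w 0 0 * f0 + w 0 1 * f1) * g1 - (w 0 0 * g0 + w 0 1 * g1) * f1 by ring.
  by rewrite Ef Eg !mul0r subrr.
have w1 : w 0 1 = 0.
  apply: (mulfI det); rewrite mulr0.
  have -> : (f0 * g1 - f1 * g0) * w 0 1 =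
    (w 0 0 * g0 + w 0 1 * g1) * f0 - (w 0 0 * f0 + w 0 1 * f1) * g0 by ring.
  by rewrite Ef Eg !mul0r subrr.
apply/esym/eqP; rewrite -subr_eq0 -/w; apply/eqP/rowP => i; rewrite [RHS]mxE.
by have [->|->] := ord2P i.
Qed.

End LocalInjectivity.

(** * The scalar product of signature (2,2) and its orthonormal frames *)

Section ScalarProduct.
Variable A : comNzRingType.
Implicit Types a b c : 'rV[A]_4.

Lemma sprodE a b : sprod a b =
  - (a 0 0 * b 0 0) + a 0 1 * b 0 1 - a 0 2 * b 0 2 + a 0 3 * b 0 3.
Proof.
rewrite /sprod /eta42 mul_mx_diag mxE 4!big_ord_recl big_ord0 !mxE/=.
have -> : lift ord0 (ord0 : 'I_3) = 1 :> 'I_4 by apply/val_inj.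
have -> : lift ord0 (lift ord0 (ord0 : 'I_2)) = 2 :> 'I_4 by apply/val_inj.
have -> : lift ord0 (lift ord0 (lift ord0 (ord0 : 'I_1))) = 3 :> 'I_4.
  by apply/val_inj.
rewrite /bump /=; ring.
Qed.

Lemma sprodC a b : sprod a b = sprod b a.
Proof. by rewrite !sprodE; ring. Qed.

Lemma sprodDl a b c : sprod (a + b) c = sprod a c + sprod b c.
Proof. by rewrite !sprodE !mxE; ring. Qed.

Lemma sprodZl (k : A) a b : sprod (k *: a) b = k * sprod a b.
Proof. by rewrite !sprodE !mxE; ring. Qed.

Lemma sprodNl a b : sprod (- a) b = - sprod a b.
Proof. by rewrite !sprodE !mxE; ring. Qed.

Lemma sprodDr a b c : sprod a (b + c) = sprod a b + sprod a c.
Proof. by rewrite !(sprodC a) sprodDl. Qed.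

Lemma sprodZr (k : A) a b : sprod a (k *: b) = k * sprod a b.
Proof. by rewrite !(sprodC a) sprodZl. Qed.

Lemma sprodNr a b : sprod a (- b) = - sprod a b.
Proof. by rewrite !(sprodC a) sprodNl. Qed.

Lemma sprod0l b : sprod 0 b = 0.
Proof. by rewrite -(scale0r 0) sprodZl mul0r. Qed.

Definition sprod_lin := (sprodDl, sprodDr, sprodNl, sprodNr, sprodZl, sprodZr).

Lemma sprod_suml (I : Type) (s : seq I) (P : pred I) (F : I -> 'rV[A]_4) b :
  sprod (\sum_(i <- s | P i) F i) b = \sum_(i <- s | P i) sprod (F i) b.
Proof.
elim/big_rec2: _ => [|i x y _ <-]; first exact: sprod0l.
by rewrite sprodDl.
Qed.

Lemma sprod_mulmx n (u : 'rV[A]_n) (J : 'M[A]_(n, 4)) b :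
  sprod b (u *m J) = (b *m eta42 A *m J^T *m u^T) 0 0.
Proof. by rewrite /sprod trmx_mul mulmxA. Qed.

End ScalarProduct.

(** If M G M^T = d with d its own inverse, then M is invertible with inverse
    G M^T d, and reading v = v G M^T d M by rows gives the coordinates of v. *)
Lemma orthonormal_expansion (A : comUnitRingType) n (M G : 'M[A]_n) (d : 'rV[A]_n) :
  M *m G *m M^T = diag_mx d -> diag_mx d *m diag_mx d = 1%:M ->
  forall v : 'rV[A]_n,
    v = \sum_i (d 0 i * (v *m G *m (row i M)^T) 0 0) *: row i M.
Proof.
move=> MGM dd v.
have : M *m (G *m M^T *m diag_mx d) = 1%:M by rewrite !mulmxA MGM.
move/mulmx1C => E; rewrite -[LHS]mulmx1 -E !mulmxA mulmx_sum_row.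
apply: eq_bigr => i _; congr (_ *: _); rewrite mul_mx_diag mxE mulrC.
by congr (_ * _); rewrite !mxE; apply: eq_bigr => j _; rewrite !mxE.
Qed.

Section Frames.
Variable R : realType.
Local Notation space := 'rV[R]_4.
Implicit Types v w e n : space.

Lemma frame_expansion e1 e2 n1 n2 :
  sprod e1 e1 = -1 -> sprod e2 e2 = 1 -> sprod e1 e2 = 0 ->
  sprod n1 n1 = -1 -> sprod n2 n2 = 1 -> sprod n1 n2 = 0 ->
  sprod e1 n1 = 0 -> sprod e1 n2 = 0 -> sprod e2 n1 = 0 -> sprod e2 n2 = 0 ->
  forall v, v = - sprod v e1 *: e1 + sprod v e2 *: e2
                - sprod v n1 *: n1 + sprod v n2 *: n2.
Proof.
move=> e11 e22 e12 n11 n22 n12 a1 a2 a3 a4 v.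
pose M : 'M[R]_4 := \matrix_(i < 4) [:: e1; e2; n1; n2]`_i.
pose d : 'rV[R]_4 := \row_(i < 4) (-1) ^+ i.+1.
have Mrow i : row i M = [:: e1; e2; n1; n2]`_i by rewrite rowK.
have MM : M *m eta42 R *m M^T = diag_mx d.
  apply/matrixP => i j.
  have -> : (M *m eta42 R *m M^T) i j = sprod (row i M) (row j M).
    rewrite /sprod !mxE; apply: eq_bigr => k _; rewrite !mxE; congr (_ * _).
    by apply: eq_bigr => l _; rewrite !mxE.
  rewrite !Mrow !mxE.
  have e21 : sprod e2 e1 = 0 by rewrite sprodC.
  have n21 : sprod n2 n1 = 0 by rewrite sprodC.
  have b1 : sprod n1 e1 = 0 by rewrite sprodC.
  have b2 : sprod n2 e1 = 0 by rewrite sprodC.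
  have b3 : sprod n1 e2 = 0 by rewrite sprodC.
  have b4 : sprod n2 e2 = 0 by rewrite sprodC.
  case: i => -[|[|[|[|//]]]] i4; case: j => -[|[|[|[|//]]]] j4 /=;
   rewrite ?(e11, e22, e12, n11, n22, n12, a1, a2, a3, a4, e21, n21, b1, b2, b3, b4)
     /= ?mulr0n ?mulr1n//; ring.
have dd : diag_mx d *m diag_mx d = 1%:M.
  rewrite mulmx_diag -diag_const_mx; congr diag_mx; apply/rowP => i; rewrite !mxE.
  by rewrite -expr2 -exprM mulnC exprM sqrrN expr1n expr1n.
rewrite {1}(orthonormal_expansion MM dd v).
have dE i : d 0 i = (-1) ^+ i.+1 by rewrite mxE.
rewrite 4!big_ord_recl big_ord0 !Mrow !dE/= /bump /= -!/(sprod v _).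
by rewrite addr0 expr1 !exprS expr0 !(mulr1, mulN1r, opprK, mul1r, scaleNr, mulrN1) !addrA.
Qed.

Lemma parseval e1 e2 n1 n2 :
  sprod e1 e1 = -1 -> sprod e2 e2 = 1 -> sprod e1 e2 = 0 ->
  sprod n1 n1 = -1 -> sprod n2 n2 = 1 -> sprod n1 n2 = 0 ->
  sprod e1 n1 = 0 -> sprod e1 n2 = 0 -> sprod e2 n1 = 0 -> sprod e2 n2 = 0 ->
  forall v w, sprod v w = - (sprod v e1 * sprod w e1) + sprod v e2 * sprod w e2
                - sprod v n1 * sprod w n1 + sprod v n2 * sprod w n2.
Proof.
move=> e11 e22 e12 n11 n22 n12 a1 a2 a3 a4 v w.
rewrite {1}(frame_expansion e11 e22 e12 n11 n22 n12 a1 a2 a3 a4 v).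
rewrite !sprod_lin !(sprodC w); ring.
Qed.

Lemma frame2_expansion (G : 'M[R]_2) (X1 X2 : 'rV[R]_2) :
  (X1 *m G *m X1^T) 0 0 = -1 -> (X2 *m G *m X2^T) 0 0 = 1 ->
  (X1 *m G *m X2^T) 0 0 = 0 -> G^T = G ->
  forall v : 'rV[R]_2, v = - (v *m G *m X1^T) 0 0 *: X1 + (v *m G *m X2^T) 0 0 *: X2.
Proof.
move=> G11 G22 G12 Gs v.
pose M : 'M[R]_2 := \matrix_(i < 2) [:: X1; X2]`_i.
pose d : 'rV[R]_2 := \row_(i < 2) (-1) ^+ i.+1.
have Mrow i : row i M = [:: X1; X2]`_i by rewrite rowK.
have G21 : (X2 *m G *m X1^T) 0 0 = 0.
  have <- : (X1 *m G *m X2^T)^T = X2 *m G *m X1^T.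
    by rewrite !trmx_mul trmxK Gs mulmxA.
  by rewrite mxE.
have MM : M *m G *m M^T = diag_mx d.
  apply/matrixP => i j.
  have -> : (M *m G *m M^T) i j = ((row i M) *m G *m (row j M)^T) 0 0.
    rewrite !mxE; apply: eq_bigr => k _; rewrite !mxE; congr (_ * _).
    by apply: eq_bigr => l _; rewrite !mxE.
  rewrite !Mrow [RHS]mxE [d _ _]mxE.
  by case: i => -[|[|//]] i4; case: j => -[|[|//]] j4 /=;
   rewrite ?(G11, G22, G12, G21) /= ?mulr0n ?mulr1n//; ring.
have dd : diag_mx d *m diag_mx d = 1%:M.
  rewrite mulmx_diag -diag_const_mx; congr diag_mx; apply/rowP => i; rewrite !mxE.
  by rewrite -expr2 -exprM mulnC exprM sqrrN expr1n expr1n.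
rewrite {1}(orthonormal_expansion MM dd v).
have dE i : d 0 i = (-1) ^+ i.+1 by rewrite mxE.
rewrite 2!big_ord_recl big_ord0 !Mrow !dE/= /bump /=.
by rewrite addr0 expr1 !exprS expr0 !(mulr1, mulN1r, opprK, mul1r, scaleNr, mulrN1).
Qed.

End Frames.

(** * Derivatives along vector fields *)

Section VectorCalculus.
Variable R : realType.
Local Notation plane := 'rV[R]_2.
Local Notation space := 'rV[R]_4.
Implicit Types (q v : plane) (U : set plane).

Lemma pdC_row U n (f : plane -> 'rV[R]_n) q i j : open U -> smooth_on U f -> U q ->
  pd i (pd j f) q = pd j (pd i f) q.
Proof.
move=> oU fs Uq.
have E k i' j' : pd i' (pd j' f) q 0 k = pd i' (pd j' (fun r => f r 0 k)) q.
  have -> := derive_coord (delta_mx 0 i') k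
    (smooth_on_differentiable (smooth_on_pd j' fs) Uq).
  apply: (@near_eq_derive _ _ _ _ _ q (delta_mx 0 i')); apply: (open_eq_near oU) => // r Ur.
  exact: derive_coord (smooth_on_differentiable fs Ur).
apply/rowP => k; have H := pdC i j oU (smooth_on_coord k oU fs) Uq.
exact (etrans (E k i j) (etrans H (esym (E k j i)))).
Qed.

Lemma differentiable_scale n (c : plane -> R) (f : plane -> 'rV[R]_n) q :
  differentiable c q -> differentiable f q ->
  differentiable (fun r => c r *: f r) q.
Proof.
move=> dc df; apply: differentiable_coords => j.
have -> : (fun r => (c r *: f r) 0 j) = c * (fun r => f r 0 j).
  by apply/funext => r; rewrite mxE.
by apply: differentiableM => //; exact: differentiable_coordE.
Qed.

Lemma derive_scale n (c : plane -> R) (f : plane -> 'rV[R]_n) q v :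
  differentiable c q -> differentiable f q ->
  'D_v (fun r => c r *: f r) q = 'D_v c q *: f q + c q *: 'D_v f q.
Proof.
move=> dc df; apply/rowP => j.
rewrite derive_coord; last exact: differentiable_scale.
have -> : (fun r => (c r *: f r) 0 j) = c * (fun r => f r 0 j).
  by apply/funext => r; rewrite mxE.
rewrite deriveM; [|apply: diff_derivable..]; [|exact: dc|exact: differentiable_coordE].
rewrite [RHS]mxE [X in _ = X + _]mxE [X in _ = _ + X]mxE (derive_coord v j df).
by rewrite addrC; congr (_ + _); exact: mulrC.
Qed.

Lemma derive_sum_fun (W : normedModType R) n (f : 'I_n -> plane -> W) q v :
  (forall i, differentiable (f i) q) ->
  'D_v (fun r => \sum_i f i r) q = \sum_i 'D_v (f i) q.
Proof.
move=> df; have -> : (fun r => \sum_i f i r) = \sum_i f i.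
  by apply/funext => r; rewrite fct_sumE.
by rewrite derive_sum// => i; exact: diff_derivable.
Qed.

Lemma sprod_fctE (f g : plane -> space) :
  (fun r => sprod (f r) (g r)) =
  - ((fun r => f r 0 0) * (fun r => g r 0 0)) +
  (fun r => f r 0 1) * (fun r => g r 0 1) -
  (fun r => f r 0 2) * (fun r => g r 0 2) +
  (fun r => f r 0 3) * (fun r => g r 0 3).
Proof. by apply/funext => r; rewrite sprodE. Qed.

Lemma differentiable_sprod (f g : plane -> space) q :
  differentiable f q -> differentiable g q ->
  differentiable (fun r => sprod (f r) (g r)) q.
Proof.
move=> df dg; rewrite sprod_fctE.
have dM j : differentiable ((fun r => f r 0 j) * (fun r => g r 0 j)) q.
  by apply: differentiableM; exact: differentiable_coordE.
exact (differentiableD (differentiableB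
  (differentiableD (differentiableN (dM 0)) (dM 1)) (dM 2)) (dM 3)).
Qed.

Lemma derive_sprod (f g : plane -> space) q v :
  differentiable f q -> differentiable g q ->
  'D_v (fun r => sprod (f r) (g r)) q =
  sprod ('D_v f q) (g q) + sprod (f q) ('D_v g q).
Proof.
move=> df dg; rewrite sprod_fctE.
have dM j : is_derive q v ((fun r => f r 0 j) * (fun r => g r 0 j))
    (f q 0 j * 'D_v g q 0 j + 'D_v f q 0 j * g q 0 j).
  have dfj : differentiable (fun r => f r 0 j) q by exact: differentiable_coordE.
  have dgj : differentiable (fun r => g r 0 j) q by exact: differentiable_coordE.
  apply: DeriveDef; first by apply: diff_derivable; exact: differentiableM.
  rewrite deriveM; [|exact: diff_derivable..].
  by rewrite !derive_coord// [X in _ + X]mulrC.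
have H := is_deriveD (is_deriveB (is_deriveD (is_deriveN (dM 0)) (dM 1)) (dM 2)) (dM 3).
rewrite (@derive_val _ _ _ _ _ _ _ H) !sprodE.
by move: ('D_v f q) ('D_v g q) (f q) (g q); clear => a b c d; ring.
Qed.

Lemma smooth_on_sprod U (f g : plane -> space) : open U ->
  smooth_on U f -> smooth_on U g -> smooth_on U (fun r => sprod (f r) (g r)).
Proof.
move=> oU fs gs.
have -> : (fun r => sprod (f r) (g r)) = (fun r => - (f r 0 0 * g r 0 0) +
    f r 0 1 * g r 0 1 - f r 0 2 * g r 0 2 + f r 0 3 * g r 0 3).
  by apply/funext => r; rewrite sprodE.
have sM j : smooth_on U (fun r => f r 0 j * g r 0 j).
  by apply: smooth_onM => //; exact: smooth_on_coord.
exact (smooth_onD oU (smooth_onD oU (smooth_onD oU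
  (smooth_onN oU (sM 0)) (sM 1)) (smooth_onN oU (sM 2))) (sM 3)).
Qed.

Lemma smooth_on_cst_row U n (c : 'rV[R]_n) : open U ->
  smooth_on U (fun _ : plane => c).
Proof. by move=> oU; apply: smooth_on_coords => // j; exact: smooth_on_cst. Qed.

Lemma smooth_on_scale U n (c : plane -> R) (f : plane -> 'rV[R]_n) : open U ->
  smooth_on U c -> smooth_on U f -> smooth_on U (fun r => c r *: f r).
Proof.
move=> oU cs fs; apply: smooth_on_coords => // j.
apply: (@smooth_on_ext _ _ _ (fun r => c r * f r 0 j)) => //.
  by move=> q _; rewrite mxE.
by apply: smooth_onM => //; exact: smooth_on_coord.
Qed.

Lemma smooth_on_add U n (f g : plane -> 'rV[R]_n) : open U ->
  smooth_on U f -> smooth_on U g -> smooth_on U (fun r => f r + g r).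
Proof.
move=> oU fs gs; apply: smooth_on_coords => // j.
apply: (@smooth_on_ext _ _ _ (fun r => f r 0 j + g r 0 j)) => //.
  by move=> q _; rewrite mxE.
by apply: smooth_onD => //; exact: smooth_on_coord.
Qed.

Lemma smooth_on_derive U n (f : plane -> 'rV[R]_n) (X : plane -> plane) : open U ->
  smooth_on U f -> smooth_on U X -> smooth_on U (fun r => 'D_(X r) f r).
Proof.
move=> oU fs Xs; apply: smooth_on_coords => // j.
apply: (@smooth_on_ext _ _ _ (fun r => \sum_i X r 0 i * pd i f r 0 j)) => //.
  move=> q Uq; rewrite derive_pd; last exact: smooth_on_differentiable fs Uq.
  by rewrite summxE; apply: eq_bigr => i _; rewrite !mxE.
apply: smooth_on_sum => // i.
apply: smooth_onM => //; first exact: smooth_on_coord.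
by apply: smooth_on_coord => //; exact: smooth_on_pd.
Qed.

(** Differentiating twice separates a term in the derivative of the field from a
    symmetric, tensorial one; this is used for the commutator of fields as well as
    for the second fundamental form. *)
Lemma derive_along U n (f : plane -> 'rV[R]_n) (Y : plane -> plane) q v :
  open U -> smooth_on U f -> U q -> differentiable Y q ->
  'D_v (fun r => 'D_(Y r) f r) q =
  'D_('D_v Y q) f q + \sum_i \sum_j (v 0 i * Y q 0 j) *: pd i (pd j f) q.
Proof.
move=> oU fs Uq dY.
have dpd j : differentiable (pd j f) q.
  exact: smooth_on_differentiable (smooth_on_pd j fs) Uq.
transitivity ('D_v (fun r => \sum_j Y r 0 j *: pd j f r) q).
  apply: near_eq_derive; apply: (open_eq_near oU) => // r Ur.
  by rewrite derive_pd//; exact: smooth_on_differentiable fs Ur.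
rewrite derive_sum_fun; last first.
  by move=> j; apply: differentiable_scale => //; exact: differentiable_coordE.
rewrite derive_pd; last exact: smooth_on_differentiable fs Uq.
rewrite exchange_big -big_split/=; apply: eq_bigr => j _.
rewrite derive_scale//; last exact: differentiable_coordE.
rewrite derive_coord//; congr (_ + _).
rewrite (derive_pd _ (dpd j)) scaler_sumr; apply: eq_bigr => i _.
by rewrite scalerA mulrC.
Qed.

Lemma derive_commutator U n (f : plane -> 'rV[R]_n) (X Y : plane -> plane) q :
  open U -> smooth_on U f -> U q -> differentiable X q -> differentiable Y q ->
  'D_(X q) (fun r => 'D_(Y r) f r) q - 'D_(Y q) (fun r => 'D_(X r) f r) q =
  'D_(lie_bracket X Y q) f q.
Proof.
move=> oU fs Uq dX dY; rewrite !(derive_along _ oU fs Uq)//.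
have df : differentiable f q by exact: smooth_on_differentiable fs Uq.
set S1 := \sum_i \sum_j (X q 0 i * Y q 0 j) *: _.
have -> : \sum_i \sum_j (Y q 0 i * X q 0 j) *: pd i (pd j f) q = S1.
  rewrite exchange_big; apply: eq_bigr => i _; apply: eq_bigr => j _ /=.
  have H := pdC_row j i oU fs Uq.
  by rewrite [X in X *: _]mulrC [X in _ *: X = _]H.
have cancel (V : zmodType) (a b s : V) : a + s - (b + s) = a - b.
  by rewrite opprD addrACA subrr addr0.
rewrite cancel /lie_bracket.
by rewrite (deriveE ('D_(X q) Y q) df) (deriveE ('D_(Y q) X q) df)
  (deriveE (_ - _) df) linearB.
Qed.

(** The exterior derivative of the 1-form de2 . e1 is de1 ^ de2: second
    derivatives of e2 enter only through the commutator, which the Lie bracket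
    term cancels. *)
Lemma structure_equation U (X Y : plane -> plane) (e1 e2 : plane -> space) q :
  open U -> smooth_on U e1 -> smooth_on U e2 -> smooth_on U X -> smooth_on U Y ->
  U q ->
  'D_(X q) (fun r => sprod ('D_(Y r) e2 r) (e1 r)) q
  - 'D_(Y q) (fun r => sprod ('D_(X r) e2 r) (e1 r)) q
  - sprod ('D_(lie_bracket X Y q) e2 q) (e1 q) =
  sprod ('D_(X q) e1 q) ('D_(Y q) e2 q) - sprod ('D_(Y q) e1 q) ('D_(X q) e2 q).
Proof.
move=> oU s1 s2 sX sY Uq.
have dX := smooth_on_differentiable sX Uq.
have dY := smooth_on_differentiable sY Uq.
have d1 := smooth_on_differentiable s1 Uq.
have dXe := smooth_on_differentiable (smooth_on_derive oU s2 sX) Uq.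
have dYe := smooth_on_differentiable (smooth_on_derive oU s2 sY) Uq.
have E1 := derive_sprod (X q) dYe d1.
have E2 := derive_sprod (Y q) dXe d1.
have E3 := derive_commutator oU s2 Uq dX dY.
refine (etrans (f_equal2 (fun a b => a - b - _) E1 E2) _).
rewrite -{}E3.
have alg (a b c d c' d' e : space) :
    sprod a e + sprod d' c - (sprod b e + sprod c' d) - sprod (a - b) e =
    sprod c d' - sprod d c'.
  by rewrite sprodDl sprodNl (sprodC c) (sprodC d); ring.
exact: alg.
Qed.

End VectorCalculus.

(** * Fundamental forms, normal projection and Levi-Civita connection *)

Section Surface.
Variable R : realType.
Local Notation plane := 'rV[R]_2.
Local Notation space := 'rV[R]_4.
Implicit Types (p q a b c : plane) (v w : space) (U : set plane).
Implicit Types (x : plane -> space) (X Y Z : plane -> plane).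

Lemma row_jacobian n (f : plane -> 'rV[R]_n) q i :
  differentiable f q -> row i ('J f q) = pd i f q.
Proof. by move=> df; rewrite /pd deriveEjacobian// rowE. Qed.

Lemma mul_jacobian n (f : plane -> 'rV[R]_n) q a :
  differentiable f q -> a *m 'J f q = \sum_i a 0 i *: pd i f q.
Proof. by move=> df; rewrite -derive_pd// deriveEjacobian. Qed.

Lemma pushE x U X q : smooth_on U x -> U q -> push x X q = 'D_(X q) x q.
Proof.
by move=> sx Uq; rewrite deriveEjacobian//; exact: smooth_on_differentiable sx Uq.
Qed.

Lemma smooth_push x U X : open U -> smooth_on U x -> smooth_on U X ->
  smooth_on U (push x X).
Proof.
move=> oU sx sX; apply: smooth_on_ext (smooth_on_derive oU sx sX) => // q Uq.
by rewrite (pushE _ sx Uq).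
Qed.

Lemma metricE x X Y q : metric x X Y q = sprod (push x X q) (push x Y q).
Proof. by rewrite /metric /push /first_form /sprod trmx_mul !mulmxA. Qed.

Lemma first_formE x q a b :
  (a *m first_form x q *m b^T) 0 0 = sprod (a *m 'J x q) (b *m 'J x q).
Proof. by rewrite /first_form /sprod trmx_mul !mulmxA. Qed.

Lemma first_form_sym x q : (first_form x q)^T = first_form x q.
Proof.
rewrite /first_form !trmx_mul trmxK mulmxA; congr (_ *m _ *m _).
by rewrite /eta42 tr_diag_mx.
Qed.

Lemma first_form_pd x q i j : differentiable x q ->
  first_form x q i j = sprod (pd i x q) (pd j x q).
Proof.
move=> dx; rewrite -!row_jacobian// !rowE -first_formE.
by rewrite -rowE trmx_delta -colE !mxE.
Qed.

(** For l > 0, an orthonormal frame scaled by the square root of l. *)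
Definition conformal_frame x q (l : R) a b : Prop :=
  [/\ sprod (a *m 'J x q) (a *m 'J x q) = - l,
      sprod (b *m 'J x q) (b *m 'J x q) = l &
      sprod (a *m 'J x q) (b *m 'J x q) = 0].

Lemma tangent_frame_conformal x U X1 X2 q : tangent_frame x U X1 X2 -> U q ->
  conformal_frame x q 1 (X1 q) (X2 q).
Proof. by case=> _ _ H /H[]; rewrite !metricE. Qed.

Section PointFrame.
Variables (x : plane -> space) (q : plane) (a1 a2 : plane).
Let e1 := a1 *m 'J x q.
Let e2 := a2 *m 'J x q.
Hypotheses (e11 : sprod e1 e1 = -1) (e22 : sprod e2 e2 = 1)
  (e12 : sprod e1 e2 = 0).

Lemma tangent_expansion a :
  a = - sprod (a *m 'J x q) e1 *: a1 + sprod (a *m 'J x q) e2 *: a2.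
Proof.
rewrite -!first_formE; apply: frame2_expansion; rewrite ?first_formE//.
exact: first_form_sym.
Qed.

Lemma first_form_unit : first_form x q \in unitmx.
Proof.
rewrite -row_free_unit -kermx_eq0; apply/rowV0P => a /sub_kermxP aG.
have := tangent_expansion a; rewrite -!first_formE aG !mul0mx !mxE.
by rewrite oppr0 !scale0r addr0.
Qed.

Lemma normal_spaceP v :
  (v <= normal_space x q)%MS <-> forall a, sprod v (a *m 'J x q) = 0.
Proof.
rewrite /normal_space; split=> [/sub_kermxP vN a|vN].
  by rewrite sprod_mulmx -(mulmxA v) vN mul0mx mxE.
apply/sub_kermxP/rowP => i; rewrite mulmxA.
have := vN (delta_mx 0 i); rewrite sprod_mulmx trmx_delta -colE !mxE => ->.
by [].
Qed.

Lemma normal_tangent0 : (normal_space x q :&: tangent_space x q)%MS = 0.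
Proof.
apply/eqP/rowV0P => v; rewrite sub_capmx => /andP[/normal_spaceP vN].
rewrite /tangent_space genmxE => /submxP[a va].
rewrite va (tangent_expansion a) -va !vN.
by rewrite oppr0 !scale0r addr0 mul0mx.
Qed.

Lemma tangent_proj a : a *m 'J x q *m normal_proj x q = 0.
Proof.
rewrite /normal_proj proj_mx_0//; first exact: normal_tangent0.
by rewrite /tangent_space genmxE submxMl.
Qed.

(** The right side is orthogonal to e1 and e2, and differs from v by a tangent
    vector. *)
Lemma normal_projE v :
  v *m normal_proj x q = v + sprod v e1 *: e1 - sprod v e2 *: e2.
Proof.
set n := RHS.
have nN : (n <= normal_space x q)%MS.
  apply/normal_spaceP => a; rewrite {1}(tangent_expansion a) mulmxDl -!scalemxAl.
  rewrite -/e1 -/e2 /n !sprod_lin e11 e22 (sprodC e2 e1) e12; ring.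
have -> : v = n + (- sprod v e1 *: a1 + sprod v e2 *: a2) *m 'J x q.
  rewrite mulmxDl -!scalemxAl -/e1 -/e2 /n.
  by apply/rowP => k; rewrite !mxE; ring.
rewrite mulmxDl tangent_proj addr0 /normal_proj proj_mx_id//.
exact: normal_tangent0.
Qed.

Lemma sprod_normal_proj v w :
  sprod (v *m normal_proj x q) (w *m normal_proj x q) =
  sprod v w + sprod v e1 * sprod w e1 - sprod v e2 * sprod w e2.
Proof.
rewrite !normal_projE !sprod_lin e11 e22 e12 (sprodC e2 e1) e12.
rewrite (sprodC e1 w) (sprodC e2 w); ring.
Qed.

End PointFrame.

(** The second derivative of x as a bilinear map. *)
Definition hess x q a b : space :=
  \sum_i \sum_j (a 0 i * b 0 j) *: pd i (pd j x) q.
(** The second fundamental form on tangent vectors at one point, visibly bilinear;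
    on fields it agrees with [second_form] because the
    derivative of the field itself contributes a tangent vector only. *)
Definition II x q a b : space := hess x q a b *m normal_proj x q.

Lemma hessC x U q a b : open U -> smooth_on U x -> U q -> hess x q a b = hess x q b a.
Proof.
move=> oU sx Uq; rewrite /hess exchange_big; apply: eq_bigr => i _.
apply: eq_bigr => j _; have H := pdC_row j i oU sx Uq.
by rewrite mulrC [X in _ *: X = _]H.
Qed.

Lemma hessDl x q a b c : hess x q (a + b) c = hess x q a c + hess x q b c.
Proof.
rewrite /hess -big_split; apply: eq_bigr => i _ /=; rewrite -big_split.
by apply: eq_bigr => j _ /=; rewrite mxE mulrDl scalerDl.
Qed.

Lemma hessZl x q (k : R) a c : hess x q (k *: a) c = k *: hess x q a c.
Proof.
rewrite /hess scaler_sumr; apply: eq_bigr => i _; rewrite scaler_sumr.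
by apply: eq_bigr => j _; rewrite mxE scalerA mulrA.
Qed.

Lemma IIC x U q a b : open U -> smooth_on U x -> U q -> II x q a b = II x q b a.
Proof. by move=> oU sx Uq; rewrite /II (hessC _ _ oU sx Uq). Qed.

Lemma IIDl x q a b c : II x q (a + b) c = II x q a c + II x q b c.
Proof. by rewrite /II hessDl mulmxDl. Qed.

Lemma IIZl x q (k : R) a c : II x q (k *: a) c = k *: II x q a c.
Proof. by rewrite /II hessZl -scalemxAl. Qed.

Lemma derive_push x U X q a : open U -> smooth_on U x -> U q ->
  differentiable X q ->
  'D_a (push x X) q = 'D_a X q *m 'J x q + hess x q a (X q).
Proof.
move=> oU sx Uq dX.
have dx := smooth_on_differentiable sx Uq.
rewrite -(deriveEjacobian _ dx) -(derive_along a oU sx Uq dX).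
apply: near_eq_derive; apply: (open_eq_near oU Uq) => r Ur.
exact: pushE sx Ur.
Qed.

Lemma derive_push_II x U X q a a1 a2 : open U -> smooth_on U x -> U q ->
  conformal_frame x q 1 a1 a2 -> differentiable X q ->
  'D_a (push x X) q *m normal_proj x q = II x q a (X q).
Proof.
move=> oU sx Uq [e11 e22 e12] dX.
by rewrite (derive_push _ oU sx Uq dX) mulmxDl (tangent_proj e11 e22 e12) add0r.
Qed.

Lemma pd_first_form x U q i j l : open U -> smooth_on U x -> U q ->
  pd i (fun r => first_form x r j l : R^o) q =
  sprod (pd i (pd j x) q) (pd l x q) + sprod (pd j x q) (pd i (pd l x) q).
Proof.
move=> oU sx Uq.
have dpd k := smooth_on_differentiable (smooth_on_pd k sx) Uq.
refine (etrans _ (derive_sprod (delta_mx 0 i) (dpd j) (dpd l))).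
apply: near_eq_derive; apply: (open_eq_near oU Uq) => r Ur.
exact: first_form_pd (smooth_on_differentiable sx Ur).
Qed.

(** By symmetry of the second derivatives of x, the three derivatives of the metric
    add up to 2 x_ij . x_l. *)
Lemma christoffelE x U q k i j : open U -> smooth_on U x -> U q ->
  christoffel x q k i j =
  \sum_l invmx (first_form x q) k l * sprod (pd i (pd j x) q) (pd l x q).
Proof.
move=> oU sx Uq; rewrite /christoffel mulr_sumr; apply: eq_bigr => l _.
rewrite !(pd_first_form _ _ _ oU sx Uq).
have alg (aij aji ail ali ajl alj ui uj ul : space) (k' : R) :
    aji = aij -> ali = ail -> alj = ajl ->
    2^-1 * (k' * ((sprod aij ul + sprod uj ail) + (sprod aji ul + sprod ui ajl)
      - (sprod ali uj + sprod ui alj))) = k' * sprod aij ul.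
  by move=> -> -> ->; rewrite (sprodC ail); field.
exact: alg (pdC_row j i oU sx Uq) (pdC_row l i oU sx Uq) (pdC_row l j oU sx Uq).
Qed.

(** Koszul formula: the Christoffel symbols compute the tangential part of the
    derivative in the ambient space. *)
Lemma levi_civita_push x U X Y q b : open U -> smooth_on U x -> U q ->
  first_form x q \in unitmx -> differentiable Y q ->
  sprod (levi_civita x X Y q *m 'J x q) (b *m 'J x q) =
  sprod ('D_(X q) (push x Y) q) (b *m 'J x q).
Proof.
move=> oU sx Uq Gu dY; rewrite (derive_push _ oU sx Uq dY) /levi_civita.
rewrite mulmxDl !sprodDl; congr (_ + _).
set G := first_form x q in Gu *.
pose s i j : plane := \row_l sprod (pd i (pd j x) q) (pd l x q).
have -> : (\row_k \sum_i \sum_j christoffel x q k i j * X q 0 i * Y q 0 j) =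
    \sum_i \sum_j (X q 0 i * Y q 0 j) *: (s i j *m invmx G).
  apply/rowP => k; rewrite mxE summxE; apply: eq_bigr => i _.
  rewrite summxE; apply: eq_bigr => j _; rewrite [RHS]mxE -mulrA [LHS]mulrC.
  congr (_ * _).
  rewrite (christoffelE _ _ _ oU sx Uq) mxE; apply: eq_bigr => l _.
  rewrite mxE mulrC; congr (_ * _).
  by rewrite -[in LHS]first_form_sym -trmx_inv mxE.
rewrite -first_formE mulmx_suml mulmx_suml summxE /hess sprod_suml.
apply: eq_bigr => i _; rewrite !mulmx_suml summxE sprod_suml.
apply: eq_bigr => j _; rewrite -!scalemxAl [LHS]mxE sprodZl; congr (_ * _).
rewrite mulmxKV// (mul_jacobian _ (smooth_on_differentiable sx Uq)).
rewrite sprodC sprod_suml mxE; apply: eq_bigr => l _.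
by rewrite !mxE sprodZl mulrC sprodC.
Qed.

End Surface.

(** * The equations of Gauss and Ricci *)

Section CurvatureEquations.
Variable R : realType.
Local Notation plane := 'rV[R]_2.
Local Notation space := 'rV[R]_4.
Implicit Types (p q a b c : plane) (v w : space) (U : set plane).
Implicit Types (x : plane -> space) (X Y Z : plane -> plane).

Lemma derive_sprod_cst (f g : plane -> space) U q (k : R) a :
  open U -> U q -> differentiable f q -> differentiable g q ->
  (forall r, U r -> sprod (f r) (g r) = k) ->
  sprod ('D_a f q) (g q) + sprod (f q) ('D_a g q) = 0.
Proof.
move=> oU Uq df dg fg; rewrite -(derive_sprod a df dg) -(derive_cst k q a).
apply: near_eq_derive; exact: (open_eq_near oU Uq).
Qed.

Lemma derive_sprod_sqr_cst (f : plane -> space) U q (k : R) a :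
  open U -> U q -> differentiable f q ->
  (forall r, U r -> sprod (f r) (f r) = k) -> sprod ('D_a f q) (f q) = 0.
Proof.
move=> oU Uq df ff; have := derive_sprod_cst a oU Uq df df ff.
rewrite (sprodC (f q)) => /eqP; rewrite -mulr2n mulrn_eq0/= => /eqP.
exact.
Qed.

Lemma sprod_sub3 (a b c e : space) :
  sprod (a - b - c) e = sprod a e - sprod b e - sprod c e.
Proof. by rewrite !(sprodDl, sprodNl). Qed.

Section Frame.
Variables (x : plane -> space) (U : set plane) (X1 X2 : plane -> plane).
Hypotheses (oU : open U) (sx : smooth_on U x) (fX : tangent_frame x U X1 X2).
Local Notation e1 := (push x X1).
Local Notation e2 := (push x X2).

Lemma frame_smooth1 : smooth_on U e1.
Proof. by case: fX => s1 _ _; exact: smooth_push. Qed.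
Lemma frame_smooth2 : smooth_on U e2.
Proof. by case: fX => _ s2 _; exact: smooth_push. Qed.
Lemma frame_sprod11 q : U q -> sprod (e1 q) (e1 q) = -1.
Proof. by case: fX => _ _ H /H[]; rewrite metricE. Qed.
Lemma frame_sprod22 q : U q -> sprod (e2 q) (e2 q) = 1.
Proof. by case: fX => _ _ H /H[]; rewrite !metricE. Qed.
Lemma frame_sprod12 q : U q -> sprod (e1 q) (e2 q) = 0.
Proof. by case: fX => _ _ H /H[]; rewrite !metricE. Qed.

Lemma frame_D11 q a : U q -> sprod ('D_a e1 q) (e1 q) = 0.
Proof.
move=> Uq; apply: (derive_sprod_sqr_cst a oU Uq _ frame_sprod11).
exact: smooth_on_differentiable frame_smooth1 Uq.
Qed.

Lemma frame_D22 q a : U q -> sprod ('D_a e2 q) (e2 q) = 0.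
Proof.
move=> Uq; apply: (derive_sprod_sqr_cst a oU Uq _ frame_sprod22).
exact: smooth_on_differentiable frame_smooth2 Uq.
Qed.

Lemma frame_D12 q a : U q ->
  sprod ('D_a e1 q) (e2 q) = - sprod ('D_a e2 q) (e1 q).
Proof.
move=> Uq; apply/eqP; rewrite -addr_eq0 (sprodC ('D_a e2 q)); apply/eqP.
apply: (derive_sprod_cst a oU Uq _ _ frame_sprod12).
  exact: smooth_on_differentiable frame_smooth1 Uq.
exact: smooth_on_differentiable frame_smooth2 Uq.
Qed.

Lemma derive_frame_II X q a : U q -> differentiable X q ->
  'D_a (push x X) q *m normal_proj x q = II x q a (X q).
Proof.
by move=> Uq; exact: derive_push_II oU sx Uq (tangent_frame_conformal fX Uq).
Qed.

Lemma frame_normal_projE q v : U q -> v *m normal_proj x q =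
  v + sprod v (e1 q) *: e1 q - sprod v (e2 q) *: e2 q.
Proof.
move=> Uq.
exact: normal_projE (frame_sprod11 Uq) (frame_sprod22 Uq) (frame_sprod12 Uq) v.
Qed.

Lemma frame_sprod_proj0 q v u : U q -> sprod v (e1 q) = 0 -> sprod u (e2 q) = 0 ->
  sprod (v *m normal_proj x q) (u *m normal_proj x q) = sprod v u.
Proof.
move=> Uq v0 u0.
have H := sprod_normal_proj (frame_sprod11 Uq) (frame_sprod22 Uq) (frame_sprod12 Uq) v u.
apply: (etrans H); rewrite -!/(push x _ q).
by rewrite v0 u0 mul0r mulr0 addr0 subr0.
Qed.

Let w (Z : plane -> plane) r := sprod ('D_(Z r) e2 r) (e1 r).

(** The component along X2 vanishes as e2 has constant square; what remains is
    the connection form w. *)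
Lemma levi_civita_frame Z q : U q -> levi_civita x Z X2 q = - w Z q *: X1 q.
Proof.
move=> Uq; rewrite (tangent_expansion (frame_sprod11 Uq) (frame_sprod22 Uq)
  (frame_sprod12 Uq) (levi_civita x Z X2 q)).
have Gu := first_form_unit (frame_sprod11 Uq) (frame_sprod22 Uq) (frame_sprod12 Uq).
have dX2 : differentiable X2 q.
  by case: fX => _ s2 _; exact: smooth_on_differentiable s2 Uq.
rewrite !(levi_civita_push _ _ oU sx Uq Gu dX2) (frame_D22 _ Uq).
by rewrite scale0r addr0.
Qed.

(** By the previous lemma the inner covariant derivative is a multiple of X1, whose
    own derivative is orthogonal to X1; only the connection form is differentiated. *)
Lemma levi_civita2_frame Y Z q : smooth_on U Y -> U q ->
  sprod (push x (levi_civita x Z (levi_civita x Y X2)) q) (e1 q) =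
  'D_(Z q) (w Y) q.
Proof.
move=> sY Uq.
have sw : smooth_on U (fun r => - w Y r).
  apply: smooth_onN => //; apply: smooth_on_sprod => //; last exact: frame_smooth1.
  by apply: smooth_on_derive => //; exact: frame_smooth2.
have Gu := first_form_unit (frame_sprod11 Uq) (frame_sprod22 Uq) (frame_sprod12 Uq).
have sX1 : smooth_on U X1 by case: fX.
have dw := smooth_on_differentiable sw Uq.
have dW : differentiable (levi_civita x Y X2) q.
  apply: (@near_eq_differentiable _ _ _ (fun r => - w Y r *: X1 r)); last first.
    apply: differentiable_scale => //; exact: smooth_on_differentiable sX1 Uq.
  by apply: (open_eq_near oU Uq) => r Ur; rewrite levi_civita_frame.
rewrite {1}/push (levi_civita_push _ _ oU sx Uq Gu dW).
have de1 := smooth_on_differentiable frame_smooth1 Uq.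
have -> : 'D_(Z q) (push x (levi_civita x Y X2)) q =
    'D_(Z q) (fun r => - w Y r *: e1 r) q.
  apply: near_eq_derive; apply: (open_eq_near oU Uq) => r Ur.
  by rewrite {1}/push levi_civita_frame// -scalemxAl.
have -> := derive_scale (Z q) dw de1.
rewrite -/(push x X1 q) sprodDl !sprodZl (frame_D11 _ Uq) (frame_sprod11 Uq).
rewrite mulr0 addr0 mulrN1; have dw' : differentiable (w Y) q.
  have -> : w Y = - (fun r => - w Y r) by apply/funext => r; rewrite !fctE opprK.
  exact: differentiableN.
have -> : 'D_(Z q) (fun r => - w Y r) q = - 'D_(Z q) (w Y) q.
  exact (deriveN (diff_derivable (v := Z q) dw')).
exact: opprK.
Qed.

(** Up to sign the left side is the exterior derivative of the connection form,
    hence de1 ^ de2; the derivative of e1 has no component along e1 nor that of e2 along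
    e2, so only the normal components contribute. *)
Lemma gauss_equation p : U p ->
  - metric x (curvature (levi_civita x) X1 X2 X2) X1 p =
  sprod (II x p (X1 p) (X2 p)) (II x p (X1 p) (X2 p))
  - sprod (II x p (X1 p) (X1 p)) (II x p (X2 p) (X2 p)).
Proof.
move=> Up; have [sX1 sX2 _] := fX.
have dX1 := smooth_on_differentiable sX1 Up.
have dX2 := smooth_on_differentiable sX2 Up.
have Gu := first_form_unit (frame_sprod11 Up) (frame_sprod22 Up) (frame_sprod12 Up).
rewrite metricE {1}/push /curvature !mulmxBl sprod_sub3.
have E1 := levi_civita2_frame X1 sX2 Up.
have E2 := levi_civita2_frame X2 sX1 Up.
have E3 := levi_civita_push (lie_bracket X1 X2) (X1 p) oU sx Up Gu dX2.
have S := structure_equation oU frame_smooth1 frame_smooth2 sX1 sX2 Up.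
have {}S := etrans (f_equal3 (fun z1 z2 z3 : R => z1 - z2 - z3) E1 E2 E3) S.
refine (etrans (congr1 (fun z : R => - z) S) _).
rewrite opprB; congr (_ - _).
- rewrite {1}(IIC (X1 p) (X2 p) oU sx Up).
  rewrite -{1}(derive_frame_II (X2 p) Up dX1) -(derive_frame_II (X1 p) Up dX2).
  exact: esym (frame_sprod_proj0 Up (frame_D11 (X2 p) Up) (frame_D22 (X1 p) Up)).
- rewrite -(derive_frame_II (X1 p) Up dX1) -(derive_frame_II (X2 p) Up dX2).
  exact: esym (frame_sprod_proj0 Up (frame_D11 (X1 p) Up) (frame_D22 (X2 p) Up)).
Qed.

Section Normal.
Variables (n1 n2 : plane -> space).
Hypothesis fn : normal_frame x U n1 n2.

Lemma normal_smooth1 : smooth_on U n1. Proof. by case: fn. Qed.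
Lemma normal_smooth2 : smooth_on U n2. Proof. by case: fn. Qed.
Lemma normal_sprod11 q : U q -> sprod (n1 q) (n1 q) = -1.
Proof. by case: fn => _ _ H /H[]. Qed.
Lemma normal_sprod22 q : U q -> sprod (n2 q) (n2 q) = 1.
Proof. by case: fn => _ _ H /H[]. Qed.
Lemma normal_sprod12 q : U q -> sprod (n1 q) (n2 q) = 0.
Proof. by case: fn => _ _ H /H[]. Qed.
Lemma normal_tangent1 q a : U q -> sprod (n1 q) (a *m 'J x q) = 0.
Proof.
move=> Uq; case: fn => _ _ /(_ q Uq)[n1N _ _ _ _].
by apply: (normal_spaceP _ _ _).1 => //.
Qed.
Lemma normal_tangent2 q a : U q -> sprod (n2 q) (a *m 'J x q) = 0.
Proof.
move=> Uq; case: fn => _ _ /(_ q Uq)[_ n2N _ _ _].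
by apply: (normal_spaceP _ _ _).1 => //.
Qed.

Lemma normal_parseval q v u : U q -> sprod v u =
  - (sprod v (e1 q) * sprod u (e1 q)) + sprod v (e2 q) * sprod u (e2 q)
  - sprod v (n1 q) * sprod u (n1 q) + sprod v (n2 q) * sprod u (n2 q).
Proof.
move=> Uq; apply: (parseval (frame_sprod11 Uq) (frame_sprod22 Uq)
  (frame_sprod12 Uq) (normal_sprod11 Uq) (normal_sprod22 Uq) (normal_sprod12 Uq)).
- by rewrite sprodC; exact: normal_tangent1.
- by rewrite sprodC; exact: normal_tangent2.
- by rewrite sprodC; exact: normal_tangent1.
- by rewrite sprodC; exact: normal_tangent2.
Qed.

Lemma normal_projE_normal q v : U q -> v *m normal_proj x q =
  - sprod v (n1 q) *: n1 q + sprod v (n2 q) *: n2 q.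
Proof.
move=> Uq; rewrite (frame_normal_projE v Uq).
have E : v = - sprod v (e1 q) *: e1 q + sprod v (e2 q) *: e2 q
   - sprod v (n1 q) *: n1 q + sprod v (n2 q) *: n2 q.
  apply: (frame_expansion (frame_sprod11 Uq) (frame_sprod22 Uq)
  (frame_sprod12 Uq) (normal_sprod11 Uq) (normal_sprod22 Uq) (normal_sprod12 Uq)).
  - by rewrite sprodC; exact: normal_tangent1.
  - by rewrite sprodC; exact: normal_tangent2.
  - by rewrite sprodC; exact: normal_tangent1.
  - by rewrite sprodC; exact: normal_tangent2.
rewrite {1}E; move: (sprod _ _) (sprod v (e2 q)) (sprod v (n1 q)) (sprod v (n2 q)).
by move=> k1 k2 k3 k4; apply/rowP => k; rewrite !mxE; ring.
Qed.

Lemma normal_D11 q a : U q -> sprod ('D_a n1 q) (n1 q) = 0.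
Proof.
move=> Uq; apply: (derive_sprod_sqr_cst a oU Uq _ normal_sprod11).
exact: smooth_on_differentiable normal_smooth1 Uq.
Qed.

Lemma normal_D22 q a : U q -> sprod ('D_a n2 q) (n2 q) = 0.
Proof.
move=> Uq; apply: (derive_sprod_sqr_cst a oU Uq _ normal_sprod22).
exact: smooth_on_differentiable normal_smooth2 Uq.
Qed.

(** Shape operator: n is orthogonal to every tangent field, so differentiating n
    amounts to differentiating the field, with the opposite sign. *)
Lemma sprod_normal_II (n : plane -> space) X q a :
  smooth_on U n -> smooth_on U X ->
  (forall r b, U r -> sprod (n r) (b *m 'J x r) = 0) -> U q ->
  sprod ('D_a n q) (push x X q) = - sprod (n q) (II x q a (X q)).
Proof.
move=> sn sX nT Uq; apply/eqP; rewrite -addr_eq0; apply/eqP.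
have dX := smooth_on_differentiable sX Uq.
rewrite -(derive_frame_II a Uq dX) (frame_normal_projE _ Uq) sprodDr sprodNr !sprodDr.
rewrite !sprodZr.
have -> : sprod (n q) (e1 q) = 0 by exact: nT.
have -> : sprod (n q) (e2 q) = 0 by exact: nT.
rewrite !mulr0 subr0 addr0.
apply: (derive_sprod_cst a oU Uq) => [||r Ur]; last exact: nT.
  exact: smooth_on_differentiable sn Uq.
exact: smooth_on_differentiable (smooth_push oU sx sX) Uq.
Qed.

Let t (Z : plane -> plane) r := sprod ('D_(Z r) n2 r) (n1 r).

Lemma normal_connection_frame Z q : U q ->
  normal_connection x Z n2 q = - t Z q *: n1 q.
Proof.
move=> Uq; rewrite /normal_connection (normal_projE_normal _ Uq) (normal_D22 _ Uq).
by rewrite scale0r addr0.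
Qed.

(** As in the tangent case, only the connection form of the normal frame is
    differentiated. *)
Lemma normal_connection2_frame Y Z q : smooth_on U Y -> U q ->
  sprod (normal_connection x Z (normal_connection x Y n2) q) (n1 q) =
  'D_(Z q) (t Y) q.
Proof.
move=> sY Uq.
have st : smooth_on U (fun r => - t Y r).
  apply: smooth_onN => //; apply: smooth_on_sprod => //; last exact: normal_smooth1.
  by apply: smooth_on_derive => //; exact: normal_smooth2.
have dt := smooth_on_differentiable st Uq.
have dn1 := smooth_on_differentiable normal_smooth1 Uq.
rewrite {1}/normal_connection.
have -> : 'D_(Z q) (normal_connection x Y n2) q =
    'D_(Z q) (fun r => - t Y r *: n1 r) q.
  apply: near_eq_derive; apply: (open_eq_near oU Uq) => r Ur.
  exact: normal_connection_frame.
have -> := derive_scale (Z q) dt dn1.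
rewrite (normal_projE_normal _ Uq) !sprod_lin (normal_D11 _ Uq) (normal_sprod11 Uq).
rewrite (sprodC (n2 q)) (normal_sprod12 Uq).
rewrite !mulr0 !addr0 !mulrN1 opprK.
have dt' : differentiable (t Y) q.
  have -> : t Y = - (fun r => - t Y r) by apply/funext => r; rewrite !fctE opprK.
  exact: differentiableN.
have -> : 'D_(Z q) (fun r => - t Y r) q = - 'D_(Z q) (t Y) q.
  exact (deriveN (diff_derivable (v := Z q) dt')).
exact: opprK.
Qed.

Lemma normal_pair q v u : U q -> sprod v (n1 q) = 0 -> sprod u (n2 q) = 0 ->
  sprod v u =
  - (sprod v (e1 q) * sprod u (e1 q)) + sprod v (e2 q) * sprod u (e2 q).
Proof.
by move=> Uq v0 u0; rewrite (normal_parseval v u Uq) v0 u0 mul0r mulr0 addr0 subr0.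
Qed.

(** n1 has no derivative along n1 nor n2 along n2, so in the expansion of the product
    in the full frame only the tangential components remain. *)
Lemma derive_normal_pair q a b : U q ->
  sprod ('D_a n1 q) ('D_b n2 q) =
  - (sprod (n1 q) (II x q a (X1 q)) * sprod (n2 q) (II x q b (X1 q)))
  + sprod (n1 q) (II x q a (X2 q)) * sprod (n2 q) (II x q b (X2 q)).
Proof.
move=> Uq; have [sX1 sX2 _] := fX.
have A1 := sprod_normal_II a normal_smooth1 sX1 normal_tangent1 Uq.
have A2 := sprod_normal_II a normal_smooth1 sX2 normal_tangent1 Uq.
have B1 := sprod_normal_II b normal_smooth2 sX1 normal_tangent2 Uq.
have B2 := sprod_normal_II b normal_smooth2 sX2 normal_tangent2 Uq.
have alg (k1 k2 k3 k4 l1 l2 l3 l4 : R) : k1 = - l1 -> k2 = - l2 -> k3 = - l3 ->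
    k4 = - l4 -> - (k1 * k3) + k2 * k4 = - (l1 * l3) + l2 * l4.
  by move=> -> -> -> ->; rewrite !mulrNN.
exact: etrans (normal_pair Uq (normal_D11 a Uq) (normal_D22 b Uq)) (alg _ _ _ _ _ _ _ _ A1 A2 B1 B2).
Qed.

Lemma ricci_equation p : U p ->
  sprod (curvature (normal_connection x) X1 X2 n2 p) (n1 p) =
  sprod (n1 p) (II x p (X1 p) (X2 p)) *
    sprod (n2 p) (II x p (X1 p) (X1 p) + II x p (X2 p) (X2 p))
  - sprod (n1 p) (II x p (X1 p) (X1 p) + II x p (X2 p) (X2 p)) *
    sprod (n2 p) (II x p (X1 p) (X2 p)).
Proof.
move=> Up; have [sX1 sX2 _] := fX.
rewrite /curvature sprod_sub3.
have E1 := normal_connection2_frame X1 sX2 Up.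
have E2 := normal_connection2_frame X2 sX1 Up.
have E3 : sprod (normal_connection x (lie_bracket X1 X2) n2 p) (n1 p) =
    sprod ('D_(lie_bracket X1 X2 p) n2 p) (n1 p).
  by rewrite (normal_connection_frame _ Up) sprodZl (normal_sprod11 Up) mulrN1 opprK.
have S := structure_equation oU normal_smooth1 normal_smooth2 sX1 sX2 Up.
refine (etrans (f_equal3 (fun z1 z2 z3 : R => z1 - z2 - z3) E1 E2 E3) _).
refine (etrans S _).
refine (etrans (f_equal2 (fun z1 z2 : R => z1 - z2)
  (derive_normal_pair (X1 p) (X2 p) Up) (derive_normal_pair (X2 p) (X1 p) Up)) _).
rewrite !sprodDr (IIC (X2 p) (X1 p) oU sx Up).
move: (II x p (X1 p) (X1 p)) (II x p (X1 p) (X2 p)) (II x p (X2 p) (X2 p)).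
by move: (n1 p) (n2 p); clear => *; ring.
Qed.

End Normal.
End Frame.
End CurvatureEquations.

(** * Null directions and curvature *)

Section NullDirections.
Variable R : realType.
Local Notation plane := 'rV[R]_2.
Local Notation space := 'rV[R]_4.
Implicit Types (p q a b c : plane) (v w : space) (U D : set plane).
Implicit Types (x : plane -> space) (X Y Z : plane -> plane).

(** Half the value of [II] on a + b, and on a - b below, when II a a = II b b. *)
Definition null_plus x q a b : space := II x q a a + II x q a b.
Definition null_minus x q a b : space := II x q a a - II x q a b.

(** The coordinates of b1 satisfy al^2 - be^2 = l; those of b2 are orthogonal to
    them and of opposite square, hence equal to (be, al) up to a sign s. *)
Lemma conformal_frame_change x q l a1 a2 b1 b2 : 0 < l ->
  conformal_frame x q 1 a1 a2 -> conformal_frame x q l b1 b2 ->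
  exists al be s : R, [/\ al ^+ 2 - be ^+ 2 = l, s ^+ 2 = 1,
    b1 = al *: a1 + be *: a2 & b2 = s *: (be *: a1 + al *: a2)].
Proof.
move=> l0 [e11 e22 e12] [f11 f22 f12].
have E1 := tangent_expansion e11 e22 e12 b1.
have E2 := tangent_expansion e11 e22 e12 b2.
set al := - sprod _ _ in E1; set be := sprod _ _ in E1.
set ga := - sprod _ _ in E2; set de := sprod _ _ in E2.
move: f11 f22 f12; rewrite {}E1 {}E2 !mulmxDl -!scalemxAl.
move: (a1 *m 'J x q) (a2 *m 'J x q) e11 e22 e12 => e1 e2 e11 e22 e12.
rewrite !sprod_lin e11 e22 (sprodC e2 e1) e12 => f11 f22 f12.
have {}f11 : al ^+ 2 - be ^+ 2 = l by move/eqP: f11; rewrite -subr_eq0 => /eqP H; nra.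
have {}f22 : de ^+ 2 - ga ^+ 2 = l by nra.
have {}f12 : be * de = al * ga by nra.
have al0 : al != 0.
  by apply: contraTneq l0 => al0; rewrite -f11 al0 -leNgt; nra.
exists al, be, (de / al).
have gaE : ga = de / al * be.
  by apply: (mulfI al0); rewrite -f12; field.
have sq : (de / al) ^+ 2 = 1.
  have : (de / al) ^+ 2 * l = l by rewrite -{2}f22 gaE -f11; field.
  by rewrite -{2}(mul1r l) => /(mulIf (lt0r_neq0 l0)).
split=> //; rewrite scalerDr !scalerA gaE; congr (_ + _ *: _).
by field.
Qed.

(** The change of frame multiplies a1 + a2 and a1 - a2 by al + be and al - be and,
    when it reverses orientation, exchanges them; [II] is quadratic, so the
    multipliers get squared. *)
Lemma II_minimal_change x U q l a1 a2 b1 b2 :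
  open U -> smooth_on U x -> U q -> 0 < l ->
  conformal_frame x q 1 a1 a2 -> conformal_frame x q l b1 b2 ->
  II x q a1 a1 = II x q a2 a2 ->
  II x q b1 b1 = II x q b2 b2 /\
  exists k m : R, [/\ 0 < k, 0 < m, k * m = l ^+ 2 &
    null_plus x q b1 b2 = k *: null_plus x q a1 a2 /\
    null_minus x q b1 b2 = m *: null_minus x q a1 a2 \/
    null_plus x q b1 b2 = m *: null_minus x q a1 a2 /\
    null_minus x q b1 b2 = k *: null_plus x q a1 a2].
Proof.
move=> oU sx Uq l0 fa fb m0.
have [al [be [s [lE s2 -> ->]]]] := conformal_frame_change l0 fa fb.
have IID a b c : II x q c (a + b) = II x q c a + II x q c b.
  by rewrite !(IIC c _ oU sx Uq) IIDl.
have IIZ (k : R) a c : II x q c (k *: a) = k *: II x q c a.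
  by rewrite !(IIC c _ oU sx Uq) IIZl.
rewrite /null_plus /null_minus !(IID, IIZ, IIDl, IIZl) (IIC a2 a1 oU sx Uq) -m0.
move: (II x q a1 a1) (II x q a1 a2) => S T.
have s1 : s = 1 \/ s = -1.
  by move/eqP: s2; rewrite sqrf_eq1 => /orP[] /eqP ->; [left|right].
have kp : 0 < (al + be) ^+ 2 by rewrite exprn_even_gt0//=; apply: contraTneq l0;
  rewrite -lE subr_sqr => ->; rewrite mulr0 ltxx.
have km : 0 < (al - be) ^+ 2 by rewrite exprn_even_gt0//=; apply: contraTneq l0;
  rewrite -lE subr_sqr => ->; rewrite mul0r ltxx.
split.
  apply/rowP => k; rewrite !mxE.
  by case: s1 => ->; ring.
exists ((al + be) ^+ 2), ((al - be) ^+ 2); split => //.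
  by rewrite -exprMn mulrC -subr_sqr lE.
by case: s1 => ->; [left|right]; split; apply/rowP => k; rewrite !mxE; ring.
Qed.

Lemma II_normal x q a b a1 a2 c : conformal_frame x q 1 a1 a2 ->
  sprod (II x q a b) (c *m 'J x q) = 0.
Proof.
case=> e11 e22 e12.
have := tangent_expansion e11 e22 e12 c => ->.
rewrite /II (normal_projE e11 e22 e12) mulmxDl -!scalemxAl !sprod_lin.
by rewrite e11 e22 (sprodC (a2 *m _)) e12; ring.
Qed.

(** Minimality is given at each point for some frame defined around it, but the
    condition does not depend on the frame; so it holds at all points of the domain
    of a single frame. *)
Lemma minimal_frame D x : smooth_on D x -> minimal D x -> forall p, D p ->
  exists U X1 X2, [/\ neighborhood_in D p U, tangent_frame x U X1 X2 &
    forall q, U q -> II x q (X1 q) (X1 q) = II x q (X2 q) (X2 q)].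
Proof.
move=> sx mx.
have at_center p : D p -> exists U X1 X2, [/\ neighborhood_in D p U,
   tangent_frame x U X1 X2 & II x p (X1 p) (X1 p) = II x p (X2 p) (X2 p)].
  move=> Dp; have [U [X1 [X2 [[oU Up UD] fX m0]]]] := mx p Dp.
  exists U, X1, X2; split=> //.
  have [sX1 sX2 _] := fX.
  have sxU := smooth_onS UD sx.
  have dX1 := smooth_on_differentiable sX1 Up.
  have dX2 := smooth_on_differentiable sX2 Up.
  rewrite -(derive_frame_II oU sxU fX _ Up dX1) -(derive_frame_II oU sxU fX _ Up dX2).
  move/eqP: m0; rewrite scaler_eq0 invr_eq0 pnatr_eq0/= addrC subr_eq0 => /eqP m0.
  exact: esym m0.
move=> p Dp; have [U [X1 [X2 [[oU Up UD] fX _]]]] := at_center p Dp.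
exists U, X1, X2; split=> // q Uq.
have [V [Y1 [Y2 [[oV Vq VD] fY m0]]]] := at_center q (UD q Uq).
have fX' := tangent_frame_conformal fX Uq.
have fY' := tangent_frame_conformal fY Vq.
by have [] := II_minimal_change oU (smooth_onS UD sx) Uq ltr01 fY' fX' m0.
Qed.

Lemma sprodZZ (k m : R) v w : sprod (k *: v) (m *: w) = k * m * sprod v w.
Proof. by rewrite sprodZl sprodZr mulrA. Qed.

(** K and kappa may be computed in two further frames: passing to them multiplies
    u and v by k and m with k m = 1, or exchanges them, and this leaves u.v,
    (u.u)(v.v) and the square of det (u, v) unchanged. *)
Lemma curvature_null D x K kappa p a1 a2 :
  smooth_on D x -> gauss_curvature D x K -> normal_curvature D x kappa ->
  D p -> conformal_frame x p 1 a1 a2 -> II x p a1 a1 = II x p a2 a2 ->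
  K p ^+ 2 - kappa p ^+ 2 =
  sprod (null_plus x p a1 a2) (null_plus x p a1 a2) *
  sprod (null_minus x p a1 a2) (null_minus x p a1 a2).
Proof.
move=> sx gK nk Dp fa m0.
set u := null_plus x p a1 a2; set v := null_minus x p a1 a2.
have KE : K p = - sprod u v.
  have [U [X1 [X2 [[oU Up UD] fX ->]]]] := gK p Dp.
  have sxU := smooth_onS UD sx.
  have fX' := tangent_frame_conformal fX Up.
  have [mX [k [m [k0 m1 km nn]]]] := II_minimal_change oU sxU Up ltr01 fa fX' m0.
  rewrite (gauss_equation oU sxU fX Up) -mX.
  have -> : sprod (II x p (X1 p) (X2 p)) (II x p (X1 p) (X2 p))
      - sprod (II x p (X1 p) (X1 p)) (II x p (X1 p) (X1 p)) =
      - sprod (null_plus x p (X1 p) (X2 p)) (null_minus x p (X1 p) (X2 p)).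
    rewrite /null_plus /null_minus !sprod_lin.
    by rewrite (sprodC (II x p (X1 p) (X2 p)) (II x p (X1 p) (X1 p))); ring.
  congr (- _); rewrite expr1n in km.
  case: nn => -[-> ->]; rewrite sprodZZ; first by rewrite km mul1r.
  by rewrite (mulrC m) km mul1r sprodC.
have kE : kappa p ^+ 2 = sprod u v ^+ 2 - sprod u u * sprod v v.
  have [U [X1 [X2 [n1 [n2 [[oU Up UD] fX fn _ ->]]]]]] := nk p Dp.
  have sxU := smooth_onS UD sx.
  have fX' := tangent_frame_conformal fX Up.
  have [mX [k [m [k0 m1 km nn]]]] := II_minimal_change oU sxU Up ltr01 fa fX' m0.
  rewrite (ricci_equation oU sxU fX fn Up) -mX.
  have nP s t : (forall c, sprod s (c *m 'J x p) = 0) ->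
      sprod s t = - (sprod (n1 p) s * sprod (n1 p) t) + sprod (n2 p) s * sprod (n2 p) t.
    move=> sN; rewrite (normal_parseval fX fn s t Up).
    by rewrite !sN !mul0r (sprodC s) (sprodC s) (sprodC t) (sprodC t); ring.
  have uN c : sprod u (c *m 'J x p) = 0.
    by rewrite /u /null_plus !sprod_lin !(II_normal _ _ _ fa) addr0.
  have vN c : sprod v (c *m 'J x p) = 0.
    by rewrite /v /null_minus !sprod_lin !(II_normal _ _ _ fa) subr0.
  rewrite (nP u v uN) (nP u u uN) (nP v v vN).
  have -> : II x p (X1 p) (X1 p) + II x p (X1 p) (X1 p) =
     null_plus x p (X1 p) (X2 p) + null_minus x p (X1 p) (X2 p).
    by rewrite /null_plus /null_minus addrACA subrr addr0.
  have -> : II x p (X1 p) (X2 p) =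
     2^-1 *: (null_plus x p (X1 p) (X2 p) - null_minus x p (X1 p) (X2 p)).
    by rewrite /null_plus /null_minus; apply/rowP => j; rewrite !mxE; field.
  rewrite expr1n in km.
  set u' := null_plus x p (X1 p) (X2 p) in nn *.
  set v' := null_minus x p (X1 p) (X2 p) in nn *.
  rewrite -/u -/v in nn; clear KE uN vN; clearbody u v u' v'.
  have -> : (sprod (n1 p) (2^-1 *: (u' - v')) * sprod (n2 p) (u' + v') -
      sprod (n1 p) (u' + v') * sprod (n2 p) (2^-1 *: (u' - v'))) ^+ 2 =
      (sprod (n1 p) u' * sprod (n2 p) v' - sprod (n1 p) v' * sprod (n2 p) u') ^+ 2.
    by rewrite !sprodDr !sprodZr !sprodDr !sprodNr; field.
  have -> : (sprod (n1 p) u' * sprod (n2 p) v' - sprod (n1 p) v' * sprod (n2 p) u') ^+ 2 =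
      (k * m) ^+ 2 *
      (sprod (n1 p) u * sprod (n2 p) v - sprod (n1 p) v * sprod (n2 p) u) ^+ 2.
    by case: nn => -[-> ->]; rewrite !sprodZr; ring.
  by rewrite km; ring.
rewrite KE kE; ring.
Qed.

End NullDirections.

(** * Double numbers *)

Section DoubleVectors.
Variable R : realType.
Local Notation space := 'rV[R]_4.

Lemma dblE (s t : double R) : dbl_re s = dbl_re t -> dbl_im s = dbl_im t -> s = t.
Proof. by case: s t => [a b] [c d] /= -> ->. Qed.

Lemma dbl_sum I (r : seq I) (P : pred I) (F : I -> double R) :
  \sum_(i <- r | P i) F i =
  Double (\sum_(i <- r | P i) dbl_re (F i)) (\sum_(i <- r | P i) dbl_im (F i)).
Proof. by elim/big_rec3: _ => // i a b s _ ->. Qed.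

Lemma dvecE (a b : space) k : dvec a b 0 k = Double (a 0 k) (b 0 k).
Proof.
by rewrite !mxE; apply: dblE; rewrite /= !(mul0r, mulr0, mul1r, addr0, add0r).
Qed.

Lemma dvec_mul (a b : space) (N : 'M[R]_4) :
  dvec a b *m map_mx (@dbl_real R) N = dvec (a *m N) (b *m N).
Proof.
apply/rowP => k; rewrite dvecE mxE dbl_sum !mxE; congr Double.
  by apply: eq_bigr => j _; rewrite dvecE mxE /= mulr0 addr0.
by apply: eq_bigr => j _; rewrite dvecE mxE /= mulr0 add0r.
Qed.

Lemma dvec_re (a b : space) : map_mx (@dbl_re R) (dvec a b) = a.
Proof. by apply/rowP => k; rewrite mxE dvecE. Qed.

Lemma dvec_im (a b : space) : map_mx (@dbl_im R) (dvec a b) = b.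
Proof. by apply/rowP => k; rewrite mxE dvecE. Qed.

Lemma sprod_dvec (a b : space) :
  sprod (dvec a b) (dvec a b) = Double (sprod a a + sprod b b) (2 * sprod a b).
Proof. by rewrite !sprodE !dvecE; apply: dblE => /=; ring. Qed.

Lemma ddt_dvec (a b c d : space) :
  dbl_real 2^-1 *: (dvec a b + dbl_j *: dvec c d) =
  dvec (2^-1 *: (a + d)) (2^-1 *: (b + c)).
Proof.
apply/rowP => k; rewrite dvecE !mxE.
by apply: dblE => /=; ring.
Qed.

(** D_+ is an open quadrant in the coordinates u + v and u - v, the components of
    a double number with respect to the idempotents (1 + j)/2 and (1 - j)/2. *)
Lemma in_DplusE (t : double R) :
  in_Dplus t <-> 0 < dbl_re t + dbl_im t /\ 0 < dbl_re t - dbl_im t.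
Proof.
case: t => a b; rewrite /in_Dplus /dbl_norm2/=; split=> [[n0 a0]|[p m]].
  by split; nra.
by split; nra.
Qed.

Lemma dbl_norm2E (t : double R) :
  dbl_norm2 t = (dbl_re t + dbl_im t) * (dbl_re t - dbl_im t).
Proof. by rewrite /dbl_norm2; ring. Qed.

Lemma in_Dplus_jE (t : double R) :
  in_Dplus (dbl_j * t) \/ in_Dplus (- (dbl_j * t)) <-> dbl_norm2 t < 0.
Proof.
case: t => a b; rewrite /in_Dplus /dbl_norm2/= !mul0r !mul1r !add0r ?addr0 !sqrrN.
rewrite oppr_gt0; split=> [[[]|[]]|n0]; [lra|lra|].
have [b0|b0|b0] := ltgtP 0 b; [left|right|]; [split; lra|split; lra|].
by move: n0; rewrite -b0; nra.
Qed.

End DoubleVectors.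

(** * The normal part of Phi' in isothermal coordinates *)

Section Matrix22.
Variable F : fieldType.
Implicit Types M N : 'M[F]_2.

Definition det22 M := M 0 0 * M 1 1 - M 0 1 * M 1 0.

Lemma mulmx22 M N i j : (M *m N) i j = M i 0 * N 0 j + M i 1 * N 1 j.
Proof.
by rewrite mxE sum_ord2.
Qed.

Lemma matrix22P M N : M 0 0 = N 0 0 -> M 0 1 = N 0 1 -> M 1 0 = N 1 0 ->
  M 1 1 = N 1 1 -> M = N.
Proof.
move=> E00 E01 E10 E11; apply/matrixP => i j.
by have [->|->] := ord2P i; have [->|->] := ord2P j.
Qed.

Definition adj22 M : 'M[F]_2 :=
  \matrix_(i, j) if i == 0 then (if j == 0 then M 1 1 else - M 0 1)
                 else (if j == 0 then - M 1 0 else M 0 0).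

Lemma mul_adj22 M : adj22 M *m M = (det22 M)%:M.
Proof.
by apply: matrix22P; rewrite mulmx22 !mxE/= /det22 ?mulr1n ?mulr0n; ring.
Qed.

Lemma unitmx22 M : (M \in unitmx) = (det22 M != 0).
Proof.
apply/idP/idP => [Mu|d0].
  have := mulmxV Mu; set N := invmx M => MN.
  have : det22 M * det22 N = 1.
    have -> : det22 M * det22 N = det22 (M *m N) by rewrite /det22 !mulmx22; ring.
    by rewrite MN /det22 !mxE/= ?mulr1n ?mulr0n; ring.
  by apply: contra_eqN => /eqP ->; rewrite mul0r eq_sym oner_eq0.
have : ((det22 M)^-1 *: adj22 M) *m M = 1%:M.
  by rewrite -scalemxAl mul_adj22 scale_scalar_mx mulVf.
by case/mulmx1_unit.
Qed.

Lemma invmx22 M : M \in unitmx -> invmx M = (det22 M)^-1 *: adj22 M.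
Proof.
move=> Mu; have := Mu; rewrite unitmx22 => d0.
rewrite -[RHS](mulmxK Mu) -scalemxAl mul_adj22 scale_scalar_mx mulVf//.
by rewrite mul1mx.
Qed.

End Matrix22.

Section Charts.
Variable R : realType.
Local Notation plane := 'rV[R]_2.
Local Notation space := 'rV[R]_4.
Implicit Types (p q a b c : plane) (v w : space) (U D : set plane).
Implicit Types (x : plane -> space) (X Y Z : plane -> plane).

(** The inverse of a 2 x 2 matrix is a rational function of its entries. *)
Lemma coord_field_differentiable psi U i q : open U -> coordinates U psi -> U q ->
  differentiable (coord_field psi i) q.
Proof.
move=> oU [spsi _ Ju] Uq; apply: differentiable_coords => j.
pose J i j r := pd i psi r 0 j.
have JE r k l : U r -> 'J psi r k l = J k l r.
  by move=> Ur; rewrite /J -row_jacobian ?mxE//; exact: smooth_on_differentiable spsi Ur.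
have dJ k l : differentiable (J k l) q.
  apply: differentiable_coordE.
  exact: smooth_on_differentiable (smooth_on_pd k spsi) Uq.
pose d r := J 0 0 r * J 1 1 r - J 0 1 r * J 1 0 r.
have dd : differentiable d q.
  by apply: differentiableB; apply: differentiableM.
have d0 : d q != 0.
  by have := Ju q Uq; rewrite unitmx22 /det22 !JE.
have dV : differentiable (fun r => (d r)^-1) q by exact: differentiableV.
apply: (@near_eq_differentiable _ _ _
  (fun r => (d r)^-1 * (if i == 0 then (if j == 0 then J 1 1 r else - J 0 1 r)
                 else (if j == 0 then - J 1 0 r else J 0 0 r)))).
  apply: (open_eq_near oU Uq) => r Ur.
  rewrite /coord_field invmx22 ?Ju// [RHS]mxE [RHS]mxE [X in _ = _ * X]mxE.
  by rewrite /det22 !JE.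
apply: differentiableM => //.
by case: (i == 0); case: (j == 0); try exact: dJ; exact: differentiableN (dJ _ _).
Qed.

(** The two mixed terms of d(x_u + j x_v)/dt have the same normal part because
    [II] is symmetric; the derivatives of the coordinate fields are tangent. *)
Lemma dPhi_perpE x U psi p a1 a2 : open U -> smooth_on U x -> U p ->
  isothermal U x psi -> conformal_frame x p 1 a1 a2 ->
  dPhi_perp x psi p =
  dvec (2^-1 *: (II x p (coord_field psi 0 p) (coord_field psi 0 p) +
                 II x p (coord_field psi 1 p) (coord_field psi 1 p)))
       (II x p (coord_field psi 0 p) (coord_field psi 1 p)).
Proof.
move=> oU sx Up [cpsi _] fa.
have cE i j : cpd psi i (cpd psi j x) p *m normal_proj x p =
    II x p (coord_field psi i p) (coord_field psi j p).
  have dc := coord_field_differentiable j oU cpsi Up.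
  have H := derive_push_II (coord_field psi i p) oU sx Up fa dc.
  refine (etrans (f_equal (fun v : space => v *m _) _) H).
  apply: near_eq_derive; apply: (open_eq_near oU Up) => r Ur.
  exact: esym (pushE _ sx Ur).
have reE : (fun r => map_mx (@dbl_re R) (Phi x psi r)) = cpd psi 0 x.
  by apply/funext => r; exact: dvec_re.
have imE : (fun r => map_mx (@dbl_im R) (Phi x psi r)) = cpd psi 1 x.
  by apply/funext => r; exact: dvec_im.
have dE i : dcpd psi i (Phi x psi) p =
    dvec (cpd psi i (cpd psi 0 x) p) (cpd psi i (cpd psi 1 x) p).
  exact (f_equal2 (fun f g => dvec (cpd psi i f p) (cpd psi i g p)) reE imE).
have H := etrans (f_equal2 (fun s t => dbl_real 2^-1 *: (s + dbl_j *: t)) (dE 0) (dE 1))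
  (ddt_dvec _ _ _ _).
have alg (a00 a01 a10 a11 s00 s01 s11 : space) (N : 'M[R]_4) :
    a00 *m N = s00 -> a01 *m N = s01 -> a10 *m N = s01 -> a11 *m N = s11 ->
    dvec (2^-1 *: (a00 + a11)) (2^-1 *: (a01 + a10)) *m map_mx (@dbl_real R) N =
    dvec (2^-1 *: (s00 + s11)) s01.
  move=> E00 E01 E10 E11; rewrite dvec_mul -!scalemxAl !mulmxDl E00 E01 E10 E11.
  by congr (dvec _ _); apply/rowP => k; rewrite !mxE; field.
have C := IIC (coord_field psi 1 p) (coord_field psi 0 p) oU sx Up.
exact (etrans (f_equal (fun F => F *m _) H)
  (alg _ _ _ _ _ _ _ _ (cE 0 0) (cE 0 1) (etrans (cE 1 0) C) (cE 1 1))).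
Qed.

Lemma isothermal_conformal x U psi p : smooth_on U x -> U p ->
  isothermal U x psi -> exists2 l, 0 < l &
  conformal_frame x p l (coord_field psi 0 p) (coord_field psi 1 p).
Proof.
move=> sx Up [_ /(_ p Up)] /=.
rewrite /cpd -!(pushE _ sx Up) => -[E0 E1 E01].
exists (- sprod (push x (coord_field psi 0) p) (push x (coord_field psi 0) p)).
  by rewrite oppr_gt0.
by split; rewrite ?opprK// E1 opprK.
Qed.

(** The coordinate frame is conformal, and s.s + t.t plus or minus 2 s.t is the
    square of s + t or s - t. *)
Lemma dPhi_perp_sq_null x U psi p a1 a2 : open U -> smooth_on U x -> U p ->
  isothermal U x psi -> conformal_frame x p 1 a1 a2 ->
  II x p a1 a1 = II x p a2 a2 ->
  let t := dPhi_perp_sq x psi p in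
  let u := null_plus x p a1 a2 in
  let v := null_minus x p a1 a2 in
  exists k m : R, [/\ 0 < k, 0 < m &
    dbl_re t + dbl_im t = k * sprod u u /\ dbl_re t - dbl_im t = m * sprod v v \/
    dbl_re t + dbl_im t = m * sprod v v /\ dbl_re t - dbl_im t = k * sprod u u].
Proof.
move=> oU sx Up ips fa m0 t u v.
have [l l0 fb] := isothermal_conformal sx Up ips.
have [b0 [k [m [k0 m1 _ nn]]]] := II_minimal_change oU sx Up l0 fa fb m0.
exists (k ^+ 2), (m ^+ 2); split; rewrite ?exprn_gt0//.
rewrite /t /dPhi_perp_sq (dPhi_perpE oU sx Up ips fa) -b0 sprod_dvec /=.
have half (S : space) : 2^-1 *: (S + S) = S.
  by apply/rowP => j; rewrite !mxE; field.
rewrite half.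
have eP (S T : space) : sprod S S + sprod T T + 2 * sprod S T = sprod (S + T) (S + T).
  by rewrite !sprod_lin (sprodC T S); ring.
have eM (S T : space) : sprod S S + sprod T T - 2 * sprod S T = sprod (S - T) (S - T).
  by rewrite !sprod_lin (sprodC T S); ring.
rewrite eP eM -/(null_plus _ _ _ _) -/(null_minus _ _ _ _).
by case: nn => -[-> ->]; [left|right]; rewrite !sprodZZ -!expr2.
Qed.

End Charts.

(** * Isothermal coordinates on a minimal surface *)

Section ConjugateForm.
Variable R : realType.
Local Notation plane := 'rV[R]_2.
Local Notation space := 'rV[R]_4.
Implicit Types (p q b c : plane) (v w : space) (U V : set plane).
Variables (x : plane -> space) (U : set plane) (X1 X2 : plane -> plane).
Hypotheses (oU : open U) (sx : smooth_on U x) (fX : tangent_frame x U X1 X2).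
Hypothesis minU : forall q, U q -> II x q (X1 q) (X1 q) = II x q (X2 q) (X2 q).
Variable a : space.
Local Notation e1 := (push x X1).
Local Notation e2 := (push x X2).

(** The Hodge dual of d(a.x): it takes the value a.e2 on X1 and a.e1 on X2.  The
    components of the coframe dual to (X1, X2) are - e1 . x_k and e2 . x_k. *)
Definition conj_form (k : 'I_2) (q : plane) : R :=
  - (sprod (e1 q) (pd k x q) * sprod (e2 q) a) +
  sprod (e2 q) (pd k x q) * sprod (e1 q) a.

Let s1 : smooth_on U e1. Proof. exact: frame_smooth1 oU sx fX. Qed.
Let s2 : smooth_on U e2. Proof. exact: frame_smooth2 oU sx fX. Qed.

Lemma smooth_conj_form k : smooth_on U (conj_form k).
Proof.
have sk := smooth_on_pd k sx.
have sa := smooth_on_cst_row a oU.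
have E1 := smooth_onM oU (smooth_on_sprod oU s1 sk) (smooth_on_sprod oU s2 sa).
have E2 := smooth_onM oU (smooth_on_sprod oU s2 sk) (smooth_on_sprod oU s1 sa).
exact: smooth_onD oU (smooth_onN oU E1) E2.
Qed.

Lemma pd_conj_form i k q : U q -> pd i (conj_form k) q =
  - (sprod (e1 q) (pd k x q) * sprod (pd i e2 q) a +
     (sprod (pd i e1 q) (pd k x q) + sprod (e1 q) (pd i (pd k x) q)) * sprod (e2 q) a) +
  (sprod (e2 q) (pd k x q) * sprod (pd i e1 q) a +
    (sprod (pd i e2 q) (pd k x q) + sprod (e2 q) (pd i (pd k x) q)) * sprod (e1 q) a).
Proof.
move=> Uq.
have d1 := smooth_on_differentiable s1 Uq.
have d2 := smooth_on_differentiable s2 Uq.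
have dk := smooth_on_differentiable (smooth_on_pd k sx) Uq.
have da : differentiable (fun _ : plane => a) q by exact: differentiable_cst.
have prod (f g : plane -> space) : differentiable f q -> differentiable g q ->
    is_derive q (delta_mx 0 i) (fun r => sprod (f r) (g r))
      (sprod (pd i f q) (g q) + sprod (f q) (pd i g q)).
  move=> df dg; apply: DeriveDef; last exact: derive_sprod.
  by apply: diff_derivable; exact: differentiable_sprod.
have proda (f : plane -> space) : differentiable f q ->
    is_derive q (delta_mx 0 i) (fun r => sprod (f r) a) (sprod (pd i f q) a).
  move=> df; apply: (is_derive_eq (prod f _ df da)).
  have -> : pd i (fun _ : plane => a) q = 0 by exact: derive_cst.
  by rewrite (sprodC _ 0) sprod0l addr0.
have P1 := is_deriveM (prod _ _ d1 dk) (proda _ d2).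
have P2 := is_deriveM (prod _ _ d2 dk) (proda _ d1).
have P := is_deriveD (is_deriveN P1) P2.
refine (etrans (@derive_val _ _ _ _ _ _ _ P) _).
by congr (- (_ + _) + (_ + _)); exact: mulrC.
Qed.

(** Write p_k = e1 . x_k and q_k = e2 . x_k.  In the i-th derivative of the k-th
    coefficient the tangential parts of the derivatives of e1 and e2 cancel.  Up to
    terms symmetric in i and k, what remains is - a . (q_k p_i s11 + p_k q_i s22),
    and this is symmetric because s11 = s22. *)
Lemma conj_form_closed q : U q -> pd 1 (conj_form 0) q = pd 0 (conj_form 1) q.
Proof.
move=> Uq; rewrite (pd_conj_form 1 0 Uq) (pd_conj_form 0 1 Uq).
have [sX1 sX2 _] := fX.
have dX1 := smooth_on_differentiable sX1 Uq.
have dX2 := smooth_on_differentiable sX2 Uq.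
have dx := smooth_on_differentiable sx Uq.
have e11 := frame_sprod11 fX Uq.
have e22 := frame_sprod22 fX Uq.
have e12 := frame_sprod12 fX Uq.
have xk k : pd k x q = - sprod (e1 q) (pd k x q) *: e1 q + sprod (e2 q) (pd k x q) *: e2 q.
  have := tangent_expansion e11 e22 e12 (delta_mx 0 k).
  rewrite -rowE (row_jacobian _ dx) !(sprodC (pd k x q)) => H.
  have := congr1 (fun b => b *m 'J x q) H.
  by rewrite -rowE (row_jacobian _ dx) mulmxDl -!scalemxAl.
have dk k : delta_mx 0 k = - sprod (e1 q) (pd k x q) *: X1 q
    + sprod (e2 q) (pd k x q) *: X2 q :> plane.
  have := tangent_expansion e11 e22 e12 (delta_mx 0 k).
  by rewrite -rowE (row_jacobian _ dx) !(sprodC (pd k x q)).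
have N1 i : pd i e1 q = II x q (delta_mx 0 i) (X1 q) - sprod (pd i e2 q) (e1 q) *: e2 q.
  rewrite -(derive_frame_II oU sx fX (delta_mx 0 i) Uq dX1).
  rewrite (frame_normal_projE fX _ Uq) (frame_D11 oU sx fX (delta_mx 0 i) Uq).
  rewrite (frame_D12 oU sx fX (delta_mx 0 i) Uq) /pd.
  by apply/rowP => k; rewrite !mxE; ring.
have N2 i : pd i e2 q = II x q (delta_mx 0 i) (X2 q) - sprod (pd i e2 q) (e1 q) *: e1 q.
  rewrite -{1}(derive_frame_II oU sx fX (delta_mx 0 i) Uq dX2).
  rewrite (frame_normal_projE fX _ Uq) (frame_D22 oU sx fX (delta_mx 0 i) Uq) /pd.
  by apply/rowP => k; rewrite !mxE; ring.
have II_N b c d : sprod (II x q b c) (d *m 'J x q) = 0.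
  exact: II_normal (tangent_frame_conformal fX Uq).
have IIe1 b c : sprod (II x q b c) (e1 q) = 0 by exact: II_N.
have IIe2 b c : sprod (II x q b c) (e2 q) = 0 by exact: II_N.
have sym : pd 1 (pd 0 x) q = pd 0 (pd 1 x) q by exact: pdC_row oU sx Uq.
have I21 := IIC (X2 q) (X1 q) oU sx Uq.
have M := minU Uq.
have II1 i : II x q (delta_mx 0 i) (X1 q) = - sprod (e1 q) (pd i x q) *: II x q (X1 q) (X1 q)
    + sprod (e2 q) (pd i x q) *: II x q (X1 q) (X2 q).
  by rewrite {1}(dk i) IIDl !IIZl I21.
have II2 i : II x q (delta_mx 0 i) (X2 q) = - sprod (e1 q) (pd i x q) *: II x q (X1 q) (X2 q)
    + sprod (e2 q) (pd i x q) *: II x q (X1 q) (X1 q).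
  by rewrite {1}(dk i) IIDl !IIZl M.
have alg (E1 E2 x0 x1 D01 D02 D11 D12 x01 S T : space) (p0 q0 p1 q1 w0 w1 : R) :
  sprod E1 E1 = -1 -> sprod E2 E2 = 1 -> sprod E1 E2 = 0 ->
  sprod S E1 = 0 -> sprod S E2 = 0 -> sprod T E1 = 0 -> sprod T E2 = 0 ->
  x0 = - p0 *: E1 + q0 *: E2 -> x1 = - p1 *: E1 + q1 *: E2 ->
  D01 = (- p0 *: S + q0 *: T) - w0 *: E2 ->
  D11 = (- p1 *: S + q1 *: T) - w1 *: E2 ->
  D02 = (- p0 *: T + q0 *: S) - w0 *: E1 ->
  D12 = (- p1 *: T + q1 *: S) - w1 *: E1 ->
  - (sprod E1 x0 * sprod D12 a + (sprod D11 x0 + sprod E1 x01) * sprod E2 a) +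
  (sprod E2 x0 * sprod D11 a + (sprod D12 x0 + sprod E2 x01) * sprod E1 a) =
  - (sprod E1 x1 * sprod D02 a + (sprod D01 x1 + sprod E1 x01) * sprod E2 a) +
  (sprod E2 x1 * sprod D01 a + (sprod D02 x1 + sprod E2 x01) * sprod E1 a).
  move=> h11 h22 h12 S1 S2 T1 T2 -> -> -> -> -> ->.
  have h21 : sprod E2 E1 = 0 by rewrite sprodC.
  rewrite !(sprodDl, sprodNl, sprodZl, sprodDr, sprodNr, sprodZr).
  by rewrite h11 h22 h12 h21 S1 S2 T1 T2; ring.
rewrite sym; apply: (alg (e1 q) (e2 q) (pd 0 x q) (pd 1 x q) (pd 0 e1 q) (pd 0 e2 q)
  (pd 1 e1 q) (pd 1 e2 q) _ (II x q (X1 q) (X1 q)) (II x q (X1 q) (X2 q))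
  _ _ _ _ _ _ e11 e22 e12 (IIe1 _ _) (IIe2 _ _) (IIe1 _ _) (IIe2 _ _) (xk 0) (xk 1)).
- exact: etrans (N1 0) (f_equal (fun v => v - _) (II1 0)).
- exact: etrans (N1 1) (f_equal (fun v => v - _) (II1 1)).
- exact: etrans (N2 0) (f_equal (fun v => v - _) (II2 0)).
- exact: etrans (N2 1) (f_equal (fun v => v - _) (II2 1)).
Qed.

Lemma conj_form_along q c : U q ->
  \sum_k c 0 k * conj_form k q =
  - (sprod (e1 q) (c *m 'J x q) * sprod (e2 q) a) +
  sprod (e2 q) (c *m 'J x q) * sprod (e1 q) a.
Proof.
move=> Uq; rewrite (mul_jacobian _ (smooth_on_differentiable sx Uq)).
rewrite !(sprodC _ (\sum_i _)) !sprod_suml !mulr_suml -sumrN -big_split /=.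
apply: eq_bigr => k _; rewrite /conj_form !sprodZl !(sprodC (pd k x q)); ring.
Qed.

End ConjugateForm.

Section IsothermalCoordinates.
Variable R : realType.
Local Notation plane := 'rV[R]_2.
Local Notation space := 'rV[R]_4.
Implicit Types (p q b c : plane) (v w : space) (U V : set plane).

(** With a = e1(p) the gradient of h = a.x is time-like at p.  In the frame, the
    differentials of h and of its conjugate y are (al, be) and (be, al); the
    coordinate fields of (h, y) are (al X1 - be X2)/(al^2 - be^2) and
    (al X2 - be X1)/(al^2 - be^2), which are orthogonal with opposite squares. *)
Lemma isothermal_exists (x : plane -> space) U X1 X2 p :
  open U -> smooth_on U x -> tangent_frame x U X1 X2 ->
  (forall q, U q -> II x q (X1 q) (X1 q) = II x q (X2 q) (X2 q)) -> U p ->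
  exists V psi, [/\ open V, V p, V `<=` U & isothermal V x psi].
Proof.
move=> oU sx fX minU Up.
pose a := push x X1 p.
have [V0 [y [oV0 V0p V0U sy dy]]] := closed_form_primitive oU Up
  (smooth_conj_form oU sx fX a 0) (smooth_conj_form oU sx fX a 1)
  (fun q => @conj_form_closed R x U X1 X2 oU sx fX minU a q).
pose h q := sprod (x q) a.
have sh : smooth_on V0 h.
  apply: smooth_on_sprod => //; first exact: smooth_onS V0U sx.
  exact: smooth_on_cst_row.
have dh k q : V0 q -> pd k h q = sprod (pd k x q) a.
  move=> V0q; have dx := smooth_on_differentiable sx (V0U _ V0q).
  refine (etrans (derive_sprod _ dx (differentiable_cst a q)) _).
  by rewrite derive_cst (sprodC _ 0) sprod0l addr0.
pose psi q := pt (h q) (y q).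
pose al q := sprod (push x X1 q) a.
pose be q := sprod (push x X2 q) a.
have dhc q c : V0 q -> \sum_k c 0 k * pd k h q = sprod (c *m 'J x q) a.
  move=> V0q; rewrite (mul_jacobian _ (smooth_on_differentiable sx (V0U _ V0q))).
  by rewrite sprod_suml; apply: eq_bigr => k _; rewrite dh// sprodZl.
have dyc q c : V0 q -> \sum_k c 0 k * pd k y q =
    - (sprod (push x X1 q) (c *m 'J x q) * be q) +
    sprod (push x X2 q) (c *m 'J x q) * al q.
  move=> V0q; rewrite -(conj_form_along X1 X2 sx a c (V0U _ V0q)).
  have [E0 E1] := dy q V0q.
  have Ek k : pd k y q = conj_form x X1 X2 a k q.
    by have [k0|k1] := ord2P k; [rewrite k0; exact: E0|rewrite k1; exact: E1].
  by apply: eq_bigr => k _; exact: (congr1 (fun z : R => c 0 k * z) (Ek k)).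
have dhX q : V0 q -> (\sum_k X1 q 0 k * pd k h q = al q) /\
    (\sum_k X2 q 0 k * pd k h q = be q).
  by move=> V0q; rewrite !dhc.
have dyX q : V0 q -> (\sum_k X1 q 0 k * pd k y q = be q) /\
    (\sum_k X2 q 0 k * pd k y q = al q).
  move=> V0q; have V0U' := V0U _ V0q; rewrite !dyc// -!/(push x _ q).
  rewrite (frame_sprod11 fX V0U') (frame_sprod22 fX V0U') (frame_sprod12 fX V0U').
  by rewrite (sprodC (push x X2 q)) (frame_sprod12 fX V0U'); split; ring.
pose D q := pd 0 h q * pd 1 y q - pd 1 h q * pd 0 y q.
(* Evaluating dh and dy on (X1, X2) multiplies the two determinants. *)
have detE q : V0 q -> (X1 q 0 0 * X2 q 0 1 - X1 q 0 1 * X2 q 0 0) * D q =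
    al q ^+ 2 - be q ^+ 2.
  move=> V0q; have [A1 A2] := dyX q V0q; have [B1 B2] := dhX q V0q.
  have alg (a0 a1 b0 b1 h0 h1 y0 y1 u v : R) :
      a0 * h0 + a1 * h1 = u -> b0 * h0 + b1 * h1 = v ->
      a0 * y0 + a1 * y1 = v -> b0 * y0 + b1 * y1 = u ->
      (a0 * b1 - a1 * b0) * (h0 * y1 - h1 * y0) = u ^+ 2 - v ^+ 2.
    by move=> Eu Ev Ev' Eu'; rewrite !expr2 -{1}Eu -{1}Ev -Eu' -Ev'; ring.
  exact: alg (etrans (esym (sum_ord2 _)) B1) (etrans (esym (sum_ord2 _)) B2)
             (etrans (esym (sum_ord2 _)) A1) (etrans (esym (sum_ord2 _)) A2).
have V0pU := V0U _ V0p.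
have alp : al p = -1 by rewrite /al /a (frame_sprod11 fX Up).
have bep : be p = 0 by rewrite /be /a sprodC (frame_sprod12 fX Up).
have Dp : D p != 0.
  have := detE p V0p; rewrite alp bep sqrrN expr1n expr0n /= subr0.
  by apply: contra_eqN => /eqP ->; rewrite mulr0 eq_sym oner_eq0.
have sal : smooth_on U al.
  apply: smooth_on_sprod => //; first exact: frame_smooth1 oU sx fX.
  exact: smooth_on_cst_row.
have sbe : smooth_on U be.
  apply: smooth_on_sprod => //; first exact: frame_smooth2 oU sx fX.
  exact: smooth_on_cst_row.
(* At p one has al = -1 and be = 0, so that al^2 - be^2 stays positive nearby. *)
have npos : \forall q \near p, 0 < al q * al q - be q * be q.
  have c1 := differentiable_continuous (smooth_on_differentiable (smooth_onM oU sal sal) Up).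
  have c2 := differentiable_continuous (smooth_on_differentiable (smooth_onM oU sbe sbe) Up).
  have cc : {for p, continuous (fun q => al q * al q - be q * be q)} by exact: continuousB c1 c2.
  apply: (cvgr_gt _ cc); rewrite alp bep; lra.
move/nbhs_ballP : npos => [r2 /= r20 pos].
pose V1 := V0 `&` ball p r2.
have oV1 : open V1 by apply: openI => //; exact: ball_open.
have V1p : V1 p by split => //; exact: ballxx.
have V1V0 : V1 `<=` V0 by move=> q [].
have [r r0 [rV1 inj]] := jacobian_near oV1 V1p (smooth_onS V1V0 sh) (smooth_onS V1V0 sy) Dp.
pose V := ball p r.
have VV0 : V `<=` V0 by move=> q /rV1[].
have VU : V `<=` U by move=> q /VV0 /V0U.
have oV : open V by exact: ball_open.
have psiE0 : (fun q => psi q 0 0) = h by apply/funext => q; exact: pt0.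
have psiE1 : (fun q => psi q 0 1) = y by apply/funext => q; exact: pt1.
have spsi : smooth_on V psi.
  apply: smooth_on_coords => // j.
  by have [->|->] := ord2P j; rewrite ?psiE0 ?psiE1; [exact: smooth_onS VV0 sh|exact: smooth_onS VV0 sy].
have pdpsi0 q k : V q -> pd k psi q 0 0 = pd k h q.
  move=> Vq; rewrite -psiE0; exact: derive_coord (smooth_on_differentiable spsi Vq).
have pdpsi1 q k : V q -> pd k psi q 0 1 = pd k y q.
  move=> Vq; rewrite -psiE1; exact: derive_coord (smooth_on_differentiable spsi Vq).
have Jpsi0 q c : V q -> (c *m 'J psi q) 0 0 = \sum_k c 0 k * pd k h q.
  move=> Vq; rewrite (mul_jacobian _ (smooth_on_differentiable spsi Vq)) summxE.
  by apply: eq_bigr => k _; rewrite mxE pdpsi0.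
have Jpsi1 q c : V q -> (c *m 'J psi q) 0 1 = \sum_k c 0 k * pd k y q.
  move=> Vq; rewrite (mul_jacobian _ (smooth_on_differentiable spsi Vq)) summxE.
  by apply: eq_bigr => k _; rewrite mxE pdpsi1.
have Jpsi q c : V q -> c *m 'J psi q =
    pt (\sum_k c 0 k * pd k h q) (\sum_k c 0 k * pd k y q).
  by move=> Vq; rewrite -[LHS]ptE Jpsi0// Jpsi1.
pose de q := (al q ^+ 2 - be q ^+ 2)^-1.
have de0 q : V q -> 0 < al q ^+ 2 - be q ^+ 2.
  by move=> /rV1[_ /pos]; rewrite /= !expr2.
(* The rows of C are the coordinate fields of (h, y). *)
pose C q : 'M[R]_2 := \matrix_(i < 2) if i == 0
  then de q *: (al q *: X1 q - be q *: X2 q) else de q *: (al q *: X2 q - be q *: X1 q).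
have CJ q : V q -> C q *m 'J psi q = 1%:M.
  move=> Vq; apply/row_matrixP => i; rewrite row_mul.
  have [A1 A2] := dyX q (VV0 _ Vq); have [B1 B2] := dhX q (VV0 _ Vq).
  have X1J : X1 q *m 'J psi q = pt (al q) (be q) by rewrite Jpsi// A1 B1.
  have X2J : X2 q *m 'J psi q = pt (be q) (al q) by rewrite Jpsi// A2 B2.
  have d0 := lt0r_neq0 (de0 q Vq).
  rewrite rowK row1; have [->|->] := ord2P i; rewrite /= -scalemxAl mulmxBl -!scalemxAl X1J X2J;
    apply/rowP => j; rewrite !mxE; have [->|->] := ord2P j; rewrite /= /de; field; exact: d0.
have Ju q : V q -> 'J psi q \in unitmx by move=> Vq; have [] := mulmx1_unit (CJ q Vq).
have coordE q i : V q -> coord_field psi i q = row i (C q).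
  move=> Vq; rewrite /coord_field; congr row.
  by rewrite -[LHS]mul1mx -(CJ q Vq) mulmxK// Ju.
exists V, psi; split => //; first exact: ballxx.
split; first split => //.
  move=> b c /[!inE] Vb Vc bc.
  have df q : ball p r q -> differentiable h q.
    by move=> Vq; exact: smooth_on_differentiable sh (VV0 _ Vq).
  have dg q : ball p r q -> differentiable y q.
    by move=> Vq; exact: smooth_on_differentiable sy (VV0 _ Vq).
  apply: (jacobian_inj r0 df dg inj) => //.
    by have := congr1 (fun v : plane => v 0 0) bc; rewrite /psi !pt0.
  by have := congr1 (fun v : plane => v 0 1) bc; rewrite /psi !pt1.
move=> q Vq.
have cE i : cpd psi i x q = row i (C q) *m 'J x q.
  rewrite -(coordE q i Vq); exact: esym (pushE (coord_field psi i) sx (VU _ Vq)).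
have c0E : row 0 (C q) *m 'J x q = de q *: (al q *: push x X1 q - be q *: push x X2 q).
  by rewrite rowK /= -scalemxAl mulmxBl -!scalemxAl.
have c1E : row 1 (C q) *m 'J x q = de q *: (al q *: push x X2 q - be q *: push x X1 q).
  by rewrite rowK /= -scalemxAl mulmxBl -!scalemxAl.
have dV : 0 < de q by rewrite invr_gt0 de0.
have alg (E1 E2 xu xv : space) (A B d : R) : sprod E1 E1 = -1 -> sprod E2 E2 = 1 ->
    sprod E1 E2 = 0 -> 0 < d -> 0 < A ^+ 2 - B ^+ 2 ->
    xu = d *: (A *: E1 - B *: E2) -> xv = d *: (A *: E2 - B *: E1) ->
    [/\ sprod xu xu < 0, sprod xu xu = - sprod xv xv & sprod xu xv = 0].
  move=> e11 e22 e12 d0 AB -> ->.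
  have e21 : sprod E2 E1 = 0 by rewrite sprodC.
  rewrite !(sprodDl, sprodNl, sprodZl, sprodDr, sprodNr, sprodZr) e11 e22 e12 e21.
  split; [|ring..].
  have : 0 < d * (d * (A ^+ 2 - B ^+ 2)) by rewrite !mulr_gt0.
  by rewrite -oppr_lt0; congr (_ < _); ring.
exact: alg (frame_sprod11 fX (VU _ Vq)) (frame_sprod22 fX (VU _ Vq))
  (frame_sprod12 fX (VU _ Vq)) dV (de0 q Vq) (etrans (cE 0) c0E) (etrans (cE 1) c1E).
Qed.

End IsothermalCoordinates.

(** * Types of minimal surfaces *)

Section Types.
Variable R : realType.
Local Notation plane := 'rV[R]_2.
Local Notation space := 'rV[R]_4.
Implicit Types (p q a b c : plane) (v w : space) (U D : set plane).
Implicit Types (x : plane -> space) (X Y Z : plane -> plane).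

Lemma smooth_II_frame x U X1 X2 X Y : open U -> smooth_on U x ->
  tangent_frame x U X1 X2 -> smooth_on U X -> smooth_on U Y ->
  smooth_on U (fun q => II x q (X q) (Y q)).
Proof.
move=> oU sx fX sX sY.
have s1 := frame_smooth1 oU sx fX.
have s2 := frame_smooth2 oU sx fX.
have sD := smooth_on_derive oU (smooth_push oU sx sY) sX.
apply: (@smooth_on_ext _ _ _ (fun q => 'D_(X q) (push x Y) q +
  (sprod ('D_(X q) (push x Y) q) (push x X1 q) *: push x X1 q +
   - sprod ('D_(X q) (push x Y) q) (push x X2 q) *: push x X2 q))) => //.
  move=> q Uq.
  rewrite -(derive_frame_II oU sx fX (X q) Uq (smooth_on_differentiable sY Uq)).
  by rewrite (frame_normal_projE fX _ Uq) scaleNr addrA.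
apply: smooth_on_add => //; apply: smooth_on_add => //; apply: smooth_on_scale => //.
  exact: smooth_on_sprod.
by apply: smooth_onN => //; exact: smooth_on_sprod.
Qed.

Lemma null_sqr_continuous x U X1 X2 p : open U -> smooth_on U x ->
  tangent_frame x U X1 X2 -> U p ->
  {for p, continuous (fun q => sprod (null_plus x q (X1 q) (X2 q))
                                     (null_plus x q (X1 q) (X2 q)))} /\
  {for p, continuous (fun q => sprod (null_minus x q (X1 q) (X2 q))
                                     (null_minus x q (X1 q) (X2 q)))}.
Proof.
move=> oU sx fX Up; have [sX1 sX2 _] := fX.
have s11 := smooth_II_frame oU sx fX sX1 sX1.
have s12 := smooth_II_frame oU sx fX sX1 sX2.
have sp : smooth_on U (fun q => null_plus x q (X1 q) (X2 q)) by exact: smooth_on_add.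
have sm : smooth_on U (fun q => null_minus x q (X1 q) (X2 q)).
  apply: (@smooth_on_ext _ _ _ (fun q => II x q (X1 q) (X1 q) +
    (-1) *: II x q (X1 q) (X2 q))) => //.
    by move=> q _; rewrite scaleN1r.
  apply: smooth_on_add => //; apply: smooth_on_scale => //; exact: smooth_on_cst.
split; apply: differentiable_continuous.
  exact: smooth_on_differentiable (smooth_on_sprod oU sp sp) Up.
exact: smooth_on_differentiable (smooth_on_sprod oU sm sm) Up.
Qed.

(** The components of t along the idempotents (1 + j)/2 and (1 - j)/2 are, in some
    order, positive multiples of A and B.  The order is lost because a chart may
    reverse orientation. *)
Definition null_components (t : double R) (A B : R) : Prop :=
  exists k m : R, [/\ 0 < k, 0 < m &
    dbl_re t + dbl_im t = k * A /\ dbl_re t - dbl_im t = m * B \/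
    dbl_re t + dbl_im t = m * B /\ dbl_re t - dbl_im t = k * A].

Lemma null_components_Dplus t A B : null_components t A B ->
  in_Dplus t <-> 0 < A /\ 0 < B.
Proof.
move=> [k [m [k0 m0 H]]]; rewrite in_DplusE.
by case: H => -[-> ->]; rewrite !pmulr_rgt0//; split=> -[].
Qed.

Lemma null_components_DplusN t A B : null_components t A B ->
  in_Dplus (- t) <-> A < 0 /\ B < 0.
Proof.
move=> [k [m [k0 m0 H]]].
suff /null_components_Dplus -> : null_components (- t) (- A) (- B).
  by rewrite !oppr_gt0.
exists k, m; split => //=.
by case: H => -[H1 H2]; [left|right]; split;
  rewrite mulrN -?H1 -?H2 ?opprD ?opprK.
Qed.

Lemma null_components_norm2 t A B : null_components t A B ->
  exists2 l, 0 < l & dbl_norm2 t = l * (A * B).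
Proof.
move=> [k [m [k0 m0 H]]]; exists (k * m); first exact: mulr_gt0.
by rewrite dbl_norm2E; case: H => -[-> ->]; ring.
Qed.

Section Minimal.
Variables (D : set plane) (x : plane -> space).
Hypotheses (sx : smooth_on D x) (mx : minimal D x).

(** A condition on the normal part of Phi' that depends on the signs of its null
    components only may be tested in any chart, and charts exist. *)
Lemma dPhi_perp_sq_inP p a1 a2 (S : double R -> Prop) (T : Prop) : D p ->
  conformal_frame x p 1 a1 a2 -> II x p a1 a1 = II x p a2 a2 ->
  (forall t, null_components t
     (sprod (null_plus x p a1 a2) (null_plus x p a1 a2))
     (sprod (null_minus x p a1 a2) (null_minus x p a1 a2)) -> S t <-> T) ->
  dPhi_perp_sq_in S D x p <-> T.
Proof.
move=> Dp fa m0 ST; split=> [[U [psi [[oU Up UD] ips St]]]|HT].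
  apply: (ST _ _).1 St.
  exact: dPhi_perp_sq_null oU (smooth_onS UD sx) Up ips fa m0.
have [U [X1 [X2 [[oU Up UD] fX mU]]]] := minimal_frame sx mx Dp.
have sxU := smooth_onS UD sx.
have [V [psi [oV Vp VU ips]]] := isothermal_exists oU sxU fX mU Up.
exists V, psi; split => //; first by split => // q /VU /UD.
apply: (ST _ _).2 HT.
exact: dPhi_perp_sq_null oV (smooth_onS VU sxU) Vp ips fa m0.
Qed.

End Minimal.
End Types.

Theorem theorem6p3 (R : realType) (D : set 'rV[R]_2)
    (x : 'rV[R]_2 -> 'rV[R]_4) (K kappa : 'rV[R]_2 -> R) :
  timelike_surface D x ->
  minimal D x ->
  gauss_curvature D x K ->
  normal_curvature D x kappa ->
  [/\ forall p, D p -> (degenerate D x p <-> K p ^+ 2 - kappa p ^+ 2 = 0),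
      (first_type D x \/ second_type D x) <->
        (forall p, D p -> 0 < K p ^+ 2 - kappa p ^+ 2) &
      third_type D x <->
        (forall p, D p -> K p ^+ 2 - kappa p ^+ 2 < 0)].
Proof.
move=> [[oD cD D0] sx _] mx gK nk.
pose A (f : 'rV[R]_2 -> 'rV[R]_2) (g : 'rV[R]_2 -> 'rV[R]_2) q :=
  sprod (null_plus x q (f q) (g q)) (null_plus x q (f q) (g q)).
pose B (f : 'rV[R]_2 -> 'rV[R]_2) (g : 'rV[R]_2 -> 'rV[R]_2) q :=
  sprod (null_minus x q (f q) (g q)) (null_minus x q (f q) (g q)).
have local p : D p -> exists U X1 X2, [/\ open U, U p, U `<=` D,
    tangent_frame x U X1 X2 & forall q, U q ->
    [/\ K q ^+ 2 - kappa q ^+ 2 = A X1 X2 q * B X1 X2 q,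
        dPhi_perp_sq_in (@in_Dplus R) D x q <-> 0 < A X1 X2 q /\ 0 < B X1 X2 q,
        dPhi_perp_sq_in (fun t => in_Dplus (- t)) D x q <->
          A X1 X2 q < 0 /\ B X1 X2 q < 0,
        degenerate D x q <-> A X1 X2 q * B X1 X2 q = 0 &
        dPhi_perp_sq_in (fun t => in_Dplus (dbl_j * t) \/ in_Dplus (- (dbl_j * t)))
          D x q <-> A X1 X2 q * B X1 X2 q < 0]].
  move=> Dp; have [U [X1 [X2 [[oU Up UD] fX mU]]]] := minimal_frame sx mx Dp.
  exists U, X1, X2; split => // q Uq; have Dq := UD q Uq.
  have fa := tangent_frame_conformal fX Uq.
  split.
  - exact: curvature_null sx gK nk Dq fa (mU q Uq).
  - apply: (dPhi_perp_sq_inP sx mx Dq fa (mU q Uq)) => t; exact: null_components_Dplus.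
  - apply: (dPhi_perp_sq_inP sx mx Dq fa (mU q Uq)) => t; exact: null_components_DplusN.
  - apply: (dPhi_perp_sq_inP sx mx Dq fa (mU q Uq)) => t.
    move=> /null_components_norm2[l l0]; rewrite /in_D0 => ->.
    split=> [/eqP|->]; last by rewrite mulr0.
    by rewrite mulf_eq0 gt_eqF//= => /eqP.
  - apply: (dPhi_perp_sq_inP sx mx Dq fa (mU q Uq)) => t.
    by move=> /null_components_norm2[l l0]; rewrite in_Dplus_jE => ->; rewrite pmulr_rlt0.
have deg p : D p -> degenerate D x p <-> K p ^+ 2 - kappa p ^+ 2 = 0.
  move=> Dp; have [U [X1 [X2 [_ Up _ _ /(_ p Up)[KE _ _ dE _]]]]] := local p Dp.
  by rewrite KE.
have gen : (forall p, D p -> K p ^+ 2 - kappa p ^+ 2 != 0) -> general_type D x.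
  by move=> n0 p Dp /(deg p Dp)/eqP; rewrite (negbTE (n0 p Dp)).
split => //.
- split=> [[[_ ft]|[_ st]] p Dp|Kpos].
  + have [U [X1 [X2 [_ Up _ _ /(_ p Up)[-> dE _ _ _]]]]] := local p Dp.
    by have /dE[? ?] := ft p Dp; rewrite mulr_gt0.
  + have [U [X1 [X2 [_ Up _ _ /(_ p Up)[-> _ dE _ _]]]]] := local p Dp.
    by have /dE[? ?] := st p Dp; rewrite nmulr_rgt0.
  have gt : general_type D x by apply: gen => p Dp; rewrite gt_eqF// Kpos.
  pose F1 := [set p | D p /\ dPhi_perp_sq_in (@in_Dplus R) D x p].
  pose F2 := [set p | D p /\ dPhi_perp_sq_in (fun t => in_Dplus (- t)) D x p].
  have F12 p : D p -> F1 p \/ F2 p.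
    move=> Dp; have [U [X1 [X2 [_ Up _ _ /(_ p Up)[KE d1 d2 _ _]]]]] := local p Dp.
    have := Kpos p Dp; rewrite KE.
    have [A0|A0|<-] := ltgtP 0 (A X1 X2 p).
    - by rewrite pmulr_rgt0// => B0; left; split => //; apply/d1.
    - by rewrite nmulr_rgt0// => B0; right; split => //; apply/d2.
    - by rewrite mul0r ltxx.
  have disj p : F1 p -> F2 p -> False.
    move=> [Dp] + [_].
    have [U [X1 [X2 [_ Up _ _ /(_ p Up)[_ d1 d2 _ _]]]]] := local p Dp.
    by move=> /d1[A0 _] /d2[/(lt_trans A0)]; rewrite ltxx.
  have oF1 : open F1.
    rewrite openE => p [Dp]; have [U [X1 [X2 [oU Up UD fX loc]]]] := local p Dp.
    have [_ d1 _ _ _] := loc p Up => /d1[A0 B0].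
    have [cA cB] := null_sqr_continuous oU (smooth_onS UD sx) fX Up.
    have nA : \forall q \near p, 0 < A X1 X2 q by exact: cvgr_gt cA _ A0.
    have nB : \forall q \near p, 0 < B X1 X2 q by exact: cvgr_gt cB _ B0.
    apply: filterS3 (open_nbhs_nbhs (conj oU Up)) nA nB => q Uq Aq Bq.
    by split; [exact: UD|have [_ dq _ _ _] := loc q Uq; apply/dq].
  have oF2 : open F2.
    rewrite openE => p [Dp]; have [U [X1 [X2 [oU Up UD fX loc]]]] := local p Dp.
    have [_ _ d1 _ _] := loc p Up => /d1[A0 B0].
    have [cA cB] := null_sqr_continuous oU (smooth_onS UD sx) fX Up.
    have nA : \forall q \near p, A X1 X2 q < 0 by exact: cvgr_lt cA _ A0.
    have nB : \forall q \near p, B X1 X2 q < 0 by exact: cvgr_lt cB _ B0.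
    apply: filterS3 (open_nbhs_nbhs (conj oU Up)) nA nB => q Uq Aq Bq.
    by split; [exact: UD|have [_ _ dq _ _] := loc q Uq; apply/dq].
  have [F10|F1n] := pselect (F1 !=set0).
    left; split => // p Dp.
    (* Within the connected set D, the open set F1 has the open complement F2. *)
    have F1D : F1 = D.
      apply: cD => //.
        exists F1 => //; apply/seteqP; split=> [q F1q|q []//].
        by split => //; case: F1q.
      exists (~` F2); first exact: open_closedC.
      apply/seteqP; split=> [q F1q|q [Dq nF2]].
        by split; [case: F1q|move=> /(disj q F1q)].
      by have [|/nF2] := F12 q Dq.
    by have : F1 p; [rewrite F1D|case].
  right; split => // p Dp.
  by have [F1p|[]//] := F12 p Dp; exfalso; apply: F1n; exists p.
- split=> [[_ tt] p Dp|Kneg].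
    have [U [X1 [X2 [_ Up _ _ /(_ p Up)[-> _ _ _ dE]]]]] := local p Dp.
    by apply/dE; exact: tt.
  split=> [|p Dp]; first by apply: gen => p Dp; rewrite lt_eqF// Kneg.
  have [U [X1 [X2 [_ Up _ _ /(_ p Up)[KE _ _ _ dE]]]]] := local p Dp.
  by apply/dE; rewrite -KE; exact: Kneg.
Qed.
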